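(* Let $X$ be a set and $\lambda\in\mathbf{k}$. Let $\mathfrak X_\infty$ be the set of differential Rota-Baxter bracketed words on $X$, with the product $\diamond$ and the linear operators $d_{\mathfrak X}$, $P_{\mathfrak X}$ on $\mathbf{k}\mathfrak X_\infty$ defined in the context (with this $\lambda$). Then the quadruple $(\mathbf{k}\mathfrak X_\infty,\diamond,d_{\mathfrak X},P_{\mathfrak X})$, together with the inclusion map $j_X:X\to\mathbf{k}\mathfrak X_\infty$, $x\mapsto x$, is the free para-differential Rota-Baxter algebra on $X$ of type I (when $\lambda=0$) and of type II (when $\lambda\neq0$). That is, it is a para-differential Rota-Baxter algebra of that type and weight $\lambda$, and for every para-differential Rota-Baxter algebra $(R,d,P)$ of that type and weight $\lambda$ and every map $f:X\to R$ there is a unique algebra homomorphism $\bar f:\mathbf{k}\mathfrak X_\infty\to R$ with $\bar fd_{\mathfrak X}=d\bar f$, $\bar fP_{\mathfrak X}=P\bar f$ and $\bar f\circ j_X=f$.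
   Context: $\mathbf{k}$ is a commutative ring with identity. The standing convention is that, unless otherwise noted, one works in the categories of associative $\mathbf{k}$-algebras with identity, with or without linear operators. A para-differential Rota-Baxter algebra of type I or II of weight $\lambda$ is a triple $(R,d,P)$ with $R$ an algebra and $d,P:R\to R$ linear maps such that $d$ is a differential operator of weight $\lambda$, meaning $d(xy)=d(x)y+xd(y)+\lambda d(x)d(y)$ for all $x,y\in R$ and $d(\mathbf 1_R)=0$; $P$ is a Rota-Baxter operator of weight $\lambda$, meaning $P(x)P(y)=P(P(x)y)+P(xP(y))+\lambda P(xy)$ for all $x,y\in R$; and $dP=Pd$. It is of type I if $\lambda=0$ and of type II if $\lambda\ne0$. Words. For a set $Y$, $S(Y)$ is the free semigroup on $Y$ (nonempty words). For $\Omega=\{D,P\}$ with $D\neq P$, let $\mathfrak S_\Omega(X)$ be the free semigroup with two unary operations $D,P$ on $X$: $\mathfrak S_{\Omega,0}(X)=S(X)$, $\mathfrak S_{\Omega,n+1}(X)=S\big(X\sqcup P(\mathfrak S_{\Omega,n}(X))\sqcup D(\mathfrak S_{\Omega,n}(X))\big)$ with $P(Y),D(Y)$ disjoint formal copies of $Y$, and $\mathfrak S_\Omega(X)=\bigcup_n\mathfrak S_{\Omega,n}(X)$. For subsets $Y,Z$ of $\mathfrak S_\Omega(X)$ put $$\Lambda(Y,Z)=\Big(\bigcup_{r\ge1}(YP(Z))^r\Big)\cup\Big(\bigcup_{r\ge0}(YP(Z))^rY\Big)\cup\Big(\bigcup_{r\geq1}(P(Z)Y)^r\Big)\cup\Big(\bigcup_{r\ge0}(P(Z)Y)^rP(Z)\Big).$$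 Let $\Delta(X)=\{D^n(x)\mid x\in X,n\ge0\}$, $\mathfrak X_0=S(\Delta(X))$, $\mathfrak X_n=\Lambda(\mathfrak X_0,\mathfrak X_{n-1})$ for $n\ge1$; then $\mathfrak X_{n}\subseteq\mathfrak X_{n+1}$ and $\mathfrak X_\infty=\bigcup_{n\ge0}\mathfrak X_n$. Each $u\in\mathfrak X_\infty$ has a unique standard decomposition $u=u_1\cdots u_m$ with the $u_i$ alternately in $\mathfrak X_0$ and in $P(\mathfrak X_\infty)$; $\mathrm{b}(u):=m$ is the breadth, and $\mathrm{dep}_P(u):=\min\{k\mid u\in\mathfrak X_k\}$. $\mathbf{k}\mathfrak X_\infty$ is the free $\mathbf{k}$-module on $\mathfrak X_\infty$. All maps below are defined on basis elements and extended (bi)linearly; juxtaposition is concatenation, extended multilinearly. Rota-Baxter operator: $P_{\mathfrak X}(u)=P(u)$ for $u\in\mathfrak X_\infty$. Product $\diamond$, by recursion on $\mathrm{dep}_P(u)+\mathrm{dep}_P(v)$: for $u,v\in\mathfrak X_0$, $u\diamond v=uv$. If $\mathrm b(u)=\mathrm b(v)=1$, then $u\diamond v=P(\bar u\diamond P(\bar v))+P(P(\bar u)\diamond\bar v)+\lambda P(\bar u\diamond\bar v)$ when $u=P(\bar u)$ and $v=P(\bar v)$, and $u\diamond v=uv$ otherwise. If $\mathrm b(u)>1$ or $\mathrm b(v)>1$, with standard decompositions $u=u_1\cdots u_m$, $v=v_1\cdots v_n$, then $u\diamond v=u_1\cdots u_{m-1}(u_m\diamond v_1)v_2\cdots v_n$.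 Operator $d_{\mathfrak X}$, by recursion on $\mathrm{dep}_P(u)$: $d_{\mathfrak X}(u)=D(u)$ for $u\in\Delta(X)$; for $u=u_1\cdots u_m$ with $m\geq2$, where either all $u_i\in\Delta(X)$ (if $u\in\mathfrak X_0$) or $u_1\cdots u_m$ is the standard decomposition (if $u\notin\mathfrak X_0$), $$d_{\mathfrak X}(u)=d_{\mathfrak X}(u_1)u_2\cdots u_m+u_1d_{\mathfrak X}(u_2\cdots u_m)+\lambda d_{\mathfrak X}(u_1)d_{\mathfrak X}(u_2\cdots u_m);$$ and $d_{\mathfrak X}(P(\bar u))=P_{\mathfrak X}(d_{\mathfrak X}(\bar u))$ for $\bar u\in\mathfrak X_\infty$.
   Formalization: Since the words are nonempty, the constructed algebra has no identity in general; algebras here are associative but need not be unital, homomorphisms are linear and multiplicative, and d(1)=0 is required whenever an identity exists (so all unital targets are covered). *)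

(* Defs.v *)
From HB Require Import structures.
From mathcomp Require Import all_boot all_algebra finmap.
From mathcomp Require Import boolp classical_sets.
From mathcomp.multinomials Require Import monalg.

Set Implicit Arguments.
Unset Strict Implicit.
Unset Printing Implicit Defensive.

Import GRing.Theory.
Local Open Scope classical_set_scope.
Local Open Scope ring_scope.

(* Bracketed words.  A word is the list of its letters, concatenation is [++];
   the type also contains the empty word (and letters such as [LP [::]]), but
   the free semigroups below only contain nonempty lists, so that no member of
   [Xinf] has an empty word at any level. *)

Inductive letter (X : Type) : Type :=
  | Gen of X
  | LD of seq (letter X)
  | LP of seq (letter X).
Arguments Gen {X} x.
Arguments LD {X} w.
Arguments LP {X} w.

Notation word X := (seq (letter X)).

Section LetterInd.
Variables (X : Type) (Q : letter X -> Prop) (Qs : word X -> Prop).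
Hypotheses (QG : forall x, Q (Gen x))
  (QD : forall w, Qs w -> Q (LD w)) (QP : forall w, Qs w -> Q (LP w))
  (Q0 : Qs [::]) (QS : forall a w, Q a -> Qs w -> Qs (a :: w)).

Fixpoint letter_word_ind (a : letter X) : Q a :=
  let fix words w : Qs w :=
    if w is b :: w' then QS (letter_word_ind b) (words w') else Q0 in
  match a with
  | Gen x => QG x
  | LD w => QD (words w)
  | LP w => QP (words w)
  end.

Lemma word_letter_ind w : Qs w.
Proof. elim: w => [|a w IH]; first exact: Q0. exact: QS (letter_word_ind a) IH. Qed.
End LetterInd.

Section LetterChoice.
Variable X : Type.

Fixpoint tree_of_letter (a : letter X) : GenTree.tree X :=
  match a with
  | Gen x => GenTree.Leaf x
  | LD w => GenTree.Node 0 (map tree_of_letter w)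
  | LP w => GenTree.Node 1 (map tree_of_letter w)
  end.

Fixpoint letter_of_tree (t : GenTree.tree X) : letter X :=
  match t with
  | GenTree.Leaf x => Gen x
  | GenTree.Node 0 s => LD (map letter_of_tree s)
  | GenTree.Node _ s => LP (map letter_of_tree s)
  end.

Lemma tree_of_letterK : cancel tree_of_letter letter_of_tree.
Proof.
move=> a; apply: (@letter_word_ind X
  (fun a => letter_of_tree (tree_of_letter a) = a)
  (fun w => map letter_of_tree (map tree_of_letter w) = w)) => //=.
- by move=> w ->.
- by move=> w ->.
- by move=> b w -> ->.
Qed.
End LetterChoice.

HB.instance Definition _ (X : choiceType) :=
  Choice.copy (letter X) (can_type (@tree_of_letterK X)).

Section WordSets.
Variable X : choiceType.
Implicit Types (A B Y Z : set (word X)).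

Definition free_semigroup (Y : set (letter X)) : set (word X) :=
  [set w | w != [::] /\ forall a, a \in w -> Y a].

Definition setcat A B : set (word X) := [set u ++ v | u in A & v in B].
Definition setpow A (r : nat) : set (word X) := iter r (setcat A) [set [::]].
Definition setP Z : set (word X) := [set [:: LP w] | w in Z].

Definition Lambda Y Z : set (word X) :=
  (\bigcup_(r in [set r | (1 <= r)%N]) setpow (setcat Y (setP Z)) r)
  `|` (\bigcup_r setcat (setpow (setcat Y (setP Z)) r) Y)
  `|` (\bigcup_(r in [set r | (1 <= r)%N]) setpow (setcat (setP Z) Y) r)
  `|` (\bigcup_r setcat (setpow (setcat (setP Z) Y) r) (setP Z)).

Definition Delta : set (letter X) :=
  [set a | exists (n : nat) (x : X), a = iter n (fun b => LD [:: b]) (Gen x)].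

Definition X0 : set (word X) := free_semigroup Delta.

Fixpoint Xn (n : nat) : set (word X) :=
  if n is m.+1 then Lambda X0 (Xn m) else X0.

Definition Xinf : set (word X) := \bigcup_n Xn n.

End WordSets.
Arguments Xinf X : clear implicits.

(* Depth in P; on [Xinf] this is dep_P, see [XnE]. *)
Fixpoint ldepth {X} (a : letter X) : nat :=
  if a is LP w then (foldr (fun b => maxn (ldepth b)) 0%N w).+1 else 0%N.
Definition wdepth {X} (w : word X) : nat :=
  foldr (fun b => maxn (ldepth b)) 0%N w.

(* A letterwise description of [Xinf]: letters are in Delta or P(Xinf), and no
   two letters P(u), P(v) are adjacent. *)
Section Good.
Variable X : choiceType.
Implicit Types (a b : letter X) (u v w : word X).

Fixpoint is_delta a : bool :=
  match a with
  | Gen _ => true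
  | LD w => if w is [:: b] then is_delta b else false
  | LP _ => false
  end.

Definition isP a : bool := if a is LP _ then true else false.
Definition adjP a b : bool := ~~ (isP a && isP b).

Fixpoint goodl a : bool :=
  if a is LP w then [&& w != [::], all goodl w & sorted adjP w]
  else is_delta a.
Definition pregood w := all goodl w && sorted adjP w.
Definition good w := (w != [::]) && pregood w.

Lemma goodlP w : goodl (LP w) = good w. Proof. by []. Qed.

Lemma Delta_is_delta a : Delta a <-> is_delta a.
Proof.
split=> [[n [x ->]]|]; first by elim: n.
pose Q a := is_delta a -> Delta a.
apply: (@letter_word_ind X Q
  (fun w => if w is [:: b] then Q b else True)) => //=.
- by move=> x _; exists 0%N, x.
- case=> [|b [|c w]] //= Qb /Qb [n [x ->]].
  by exists n.+1, x.
- by move=> b [|].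
Qed.

Lemma is_deltaF a : goodl a -> ~~ isP a -> is_delta a.
Proof. by case: a. Qed.

Lemma is_delta_goodl a : is_delta a -> goodl a.
Proof. by case: a. Qed.

Lemma is_delta_isP a : is_delta a -> isP a = false.
Proof. by case: a. Qed.

Lemma X0P w : X0 w <-> (w != [::]) && all is_delta w.
Proof.
split=> [[-> /= H]|/andP[w0 /allP H]].
  by apply/allP => a /H /Delta_is_delta.
by split=> // a /H /Delta_is_delta.
Qed.

Lemma ldepth_delta a : is_delta a -> ldepth a = 0%N.
Proof. by case: a. Qed.

Lemma wdepth_cat u v : wdepth (u ++ v) = maxn (wdepth u) (wdepth v).
Proof. by elim: u => [|a u /= ->]; rewrite ?max0n //= maxnA. Qed.

Lemma wdepth_cons a v : wdepth (a :: v) = maxn (ldepth a) (wdepth v).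
Proof. by []. Qed.

Lemma wdepth_delta w : all is_delta w -> wdepth w = 0%N.
Proof. by elim: w => //= a w IH /andP[/ldepth_delta -> /IH ->]. Qed.

Definition ok n w := pregood w && (wdepth w <= n)%N.
Definition headD w := if w is a :: _ then ~~ isP a else true.
Definition headP w := if w is a :: _ then isP a else true.

Lemma pregood_cons a w :
  pregood (a :: w) = [&& goodl a, pregood w & if w is b :: _ then adjP a b else true].
Proof.
rewrite /pregood /=; case: w => [|b w] /=; first by rewrite !andbT.
by rewrite -!andbA; do !bool_congr.
Qed.

Lemma ok_cons n a w : ok n (a :: w) =
  [&& goodl a, (ldepth a <= n)%N, ok n w & if w is b :: _ then adjP a b else true].
Proof.
rewrite /ok pregood_cons wdepth_cons geq_max.
by case: goodl; case: pregood; case: (ldepth a <= n)%N; case: (wdepth w <= n)%N;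
  rewrite /= ?andbF ?andbT.
Qed.

Lemma ok_delta n y w : all is_delta y -> ok n w -> ok n (y ++ w).
Proof.
move=> + okw; elim: y => [|a y IH] //= /andP[da /IH {}IH].
rewrite ok_cons is_delta_goodl // ldepth_delta // IH /=.
by case: (y ++ w) => // b s; rewrite /adjP is_delta_isP.
Qed.

Lemma ok_P n z w : good z -> (wdepth z <= n)%N -> headD w -> ok n.+1 w ->
  ok n.+1 (LP z :: w).
Proof.
move=> gz dz hw okw; rewrite ok_cons okw /= ltnS.
rewrite -/(good z) /good /pregood in gz; rewrite gz.
rewrite -/(wdepth z) dz /=.
by case: w hw {okw} => //= a w; rewrite /adjP andTb.
Qed.

Lemma headD_delta y w : y != [::] -> all is_delta y -> headD (y ++ w).
Proof. by case: y => //= a y _ /andP[/is_delta_isP ->]. Qed.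

Lemma Xn_good n w : Xn n w -> good w /\ (wdepth w <= n)%N.
Proof.
suff: Xn n w -> [/\ w != [::] & ok n w].
  by move=> H /H[w0]; rewrite /ok /good w0 => /andP[-> ->].
elim: n w => [|n IH] w /=.
  move=> /X0P/andP[w0 dw]; split=> //.
  by rewrite -[w]cats0 ok_delta.
have PZ p : setP (Xn n) p -> exists z, [/\ p = [:: LP z], good z & (wdepth z <= n)%N].
  move=> [z /IH[z0 /andP[gz dz]] <-]; exists z; split=> //.
  by rewrite /good z0.
pose YP := setcat (@X0 X) (setP (Xn n)); pose PY := setcat (setP (Xn n)) (@X0 X).
have HY r T : (forall t, T t -> ok n.+1 t && headD t) ->
    forall t, setcat (setpow YP r) T t -> ok n.+1 t && headD t.
  move=> HT; elim: r => [|r IHr] t; first by move=> [_ -> [v Tv <-]]; apply: HT.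
  move=> [_ [_ [y /X0P/andP[y0 dy] [_ /PZ[z [-> gz dz]] <-]] [p' Hp' <-]] [v Tv <-]].
  rewrite -!catA cat1s headD_delta // andbT ok_delta //.
  have /IHr/andP[ok' h'] : setcat (setpow YP r) T (p' ++ v) by exists p' => //; exists v.
  exact: ok_P.
have HP r T : (forall t, T t -> ok n.+1 t) ->
    forall t, setcat (setpow PY r) T t -> ok n.+1 t.
  move=> HT; elim: r => [|r IHr] t; first by move=> [_ -> [v Tv <-]]; apply: HT.
  move=> [_ [_ [_ /PZ[z [-> gz dz]] [y /X0P/andP[y0 dy] <-]] [p' Hp' <-]] [v Tv <-]].
  rewrite -!catA cat1s ok_P ?headD_delta // ok_delta //.
  by apply: IHr; exists p' => //; exists v.
have ne r T t : (forall t, T t -> t != [::]) -> setcat (setpow YP r) T t -> t != [::].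
  by move=> HT [p _ [[|a v] /HT + <-]] //; case: p.
have ne' r T t : (forall t, T t -> t != [::]) -> setcat (setpow PY r) T t -> t != [::].
  by move=> HT [p _ [[|a v] /HT + <-]] //; case: p.
have nil A t : A t -> setcat A [set [::]] t by move=> At; exists t => //; exists [::]; rewrite ?cats0.
have X0ok t : X0 t -> ok n.+1 t && headD t.
  move=> /X0P/andP[t0 dt]; rewrite -[t]cats0 headD_delta // andbT.
  exact: ok_delta.
move=> [[[|]|]|].
- move=> [[//|r] _ Hw]; split.
    by case: Hw => _ [[|? ?] /X0P // _ [p _ <-]] [v _ <-].
  have /(HY r.+1 [set [::]]) : setcat (setpow YP r.+1) [set [::]] w by exact: nil.
  by case/(_ _)/andP => // _ ->.
- move=> [r _ Hw]; split; first by apply: ne Hw => t /X0P/andP[].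
  by have /andP[] := HY r _ X0ok _ Hw.
- move=> [[//|r] _ Hw]; split.
    by case: Hw => _ [_ [z _ <-]] [p _ <-] [v _ <-].
  have /(HP r.+1 [set [::]]) : setcat (setpow PY r.+1) [set [::]] w by exact: nil.
  by apply=> _ ->.
- move=> [r _ Hw]; split; first by apply: ne' Hw => t /PZ[z [->]].
  apply: HP Hw => t /PZ[z [-> gz dz]].
  exact: ok_P.
Qed.

Lemma split_delta w : pregood w -> exists y v,
  [/\ w = y ++ v, all is_delta y, pregood v & headP v].
Proof.
elim: w => [|a w IH]; first by move=> _; exists [::], [::].
move=> gw; case Pa: (isP a); first by exists [::], (a :: w); split=> //=.
move: gw; rewrite pregood_cons => /and3P[ga /IH[y [v [-> dy gv hv]]] _].
exists (a :: y), v; split=> //=; rewrite dy andbT; apply: is_deltaF => //.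
by rewrite Pa.
Qed.

Lemma good_Xn n w : good w -> (wdepth w <= n)%N -> Xn n w.
Proof.
elim: n w => [|n IH] w /andP[w0 gw] dw.
  have [y [[|a v] [ew dy gv hv]]] := split_delta gw.
    by apply/X0P; rewrite w0 ew cats0.
  move: dw; rewrite ew wdepth_cat wdepth_cons geq_max => /andP[_].
  by case: a hv {ew gv} => // z _; rewrite geq_max.
rewrite /=; set YP := setcat (@X0 X) (setP (Xn n)); set PY := setcat (setP (Xn n)) (@X0 X).
have X0I y : y != [::] -> all is_delta y -> X0 y by move=> *; apply/X0P/andP.
have XPI z : good z -> (wdepth z <= n)%N -> setP (Xn n) [:: LP z].
  by move=> gz dz; exists z => //; apply: IH.
have powS A B T r p t : (setcat A B) p -> setcat (setpow (setcat A B) r) T t ->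
    setcat (setpow (setcat A B) r.+1) T (p ++ t).
  move=> Hp [q Hq [v Tv <-]]; exists (p ++ q); first by exists p => //; exists q.
  by exists v => //; rewrite catA.
have pow0 A (T : set (word X)) t : T t -> setcat (setpow A 0) T t.
  by move=> Tt; exists [::] => //; exists t.
have pown A r t : setcat (setpow A r) [set [::]] t -> setpow A r t.
  by move=> [p Hp [_ -> <-]]; rewrite cats0.
have LPl z v : pregood (LP z :: v) -> (wdepth (LP z :: v) <= n.+1)%N ->
    [/\ good z, (wdepth z <= n)%N, pregood v, (wdepth v <= n.+1)%N & headD v].
  rewrite pregood_cons wdepth_cons geq_max => /and3P[gz gv hv] /andP[dz dv].
  by split=> //; case: v hv {gv dv} => // a v; rewrite /adjP andTb.
have main N v : (size v < N)%N -> pregood v -> (wdepth v <= n.+1)%N ->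
     (headD v -> (exists r, setcat (setpow YP r) [set [::]] v)
                 \/ (exists r, setcat (setpow YP r) (@X0 X) v))
  /\ (headP v -> (exists r, setcat (setpow PY r) [set [::]] v)
                 \/ (exists r, setcat (setpow PY r) (setP (Xn n)) v)).
  elim: N v => // N IHN v sv gv dv; split.
  - move=> hv; have [y [t [ev dy gt ht]]] := split_delta gv.
    case: t => [|[x|u|z] t] // in ev gt ht.
      rewrite cats0 in ev; case: (eqVneq y [::]) => [y0|y0].
        by left; exists 0%N; rewrite ev y0; apply: pow0.
      by right; exists 0%N; apply: pow0; rewrite ev; apply: X0I.
    have y0 : y != [::] by case: y ev {dy} => // ev; move: hv; rewrite ev.
    have dt : (wdepth (LP z :: t) <= n.+1)%N.
      by move: dv; rewrite ev wdepth_cat geq_max => /andP[].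
    have [gz dz gt' dt' hd] := LPl _ _ gt dt.
    have st : (size t < N)%N.
      move: sv; rewrite ev size_cat /= addnS ltnS; apply: leq_trans.
      by rewrite ltnS leq_addl.
    have Hp : YP (y ++ [:: LP z]).
      by exists y; [exact: X0I | exists [:: LP z] => //; exact: XPI].
    have -> : v = (y ++ [:: LP z]) ++ t by rewrite ev -catA.
    by have [/(_ hd)[] [r Hr] _] := IHN t st gt' dt'; [left|right];
      exists r.+1; apply: powS.
  - move=> hv; case: v => [|[x|u|z] v] // in sv gv dv hv *.
      by left; exists 0%N; apply: pow0.
    have [gz dz gv' dv' hd] := LPl _ _ gv dv.
    have [y [t [ev dy gt ht]]] := split_delta gv'.
    have [y0|y0] := eqVneq y [::].
      right; exists 0%N; apply: pow0.
      case: t => [|[x|u|z'] t] // in ev ht gt *; first by rewrite ev y0; apply: XPI.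
      by move: hd; rewrite ev y0.
    have Hp : PY ([:: LP z] ++ y).
      by exists [:: LP z]; [exact: XPI | exists y => //; exact: X0I].
    have -> : LP z :: v = ([:: LP z] ++ y) ++ t by rewrite ev -catA.
    have st : (size t < N)%N.
      by move: sv; rewrite /= ltnS ev size_cat; apply: leq_trans; rewrite ltnS leq_addl.
    have dt : (wdepth t <= n.+1)%N.
      by move: dv'; rewrite ev wdepth_cat geq_max => /andP[].
    by have [_ /(_ ht)[] [r Hr]] := IHN t st gt dt; [left|right];
      exists r.+1; apply: powS.
have [HD HP] := main _ _ (ltnSn (size w)) gw dw.
have H0 A r : setcat (setpow A r) [set [::]] w -> exists2 r', (1 <= r')%N & setpow A r' w.
  case: r => [[_ -> [_ -> ew]]|r /pown]; last by exists r.+1.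
  by rewrite -ew in w0.
have [Hh|Hh] : headD w \/ headP w by case: (w) => [|a ?] /=; [left|case: (isP a); auto].
- case: (HD Hh) => -[r Hr].
  + by left; left; left; have [r' r1 Hr'] := H0 _ _ Hr; exists r'.
  + by left; left; right; exists r.
- case: (HP Hh) => -[r Hr].
  + by left; right; have [r' r1 Hr'] := H0 _ _ Hr; exists r'.
  + by right; exists r.
Qed.

Lemma XinfP w : Xinf X w <-> good w.
Proof.
split=> [[n _ /Xn_good[]]//|gw].
by exists (wdepth w) => //; apply: good_Xn.
Qed.

Lemma in_Xinf w : (w \in Xinf X) = good w.
Proof. by apply/idP/idP => [/set_mem/XinfP|/XinfP/mem_set]. Qed.

Lemma XnE n w : Xn n w <-> Xinf X w /\ (wdepth w <= n)%N.
Proof.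
split=> [/Xn_good[/XinfP]//|[/XinfP]]; exact: good_Xn.
Qed.

End Good.
Arguments isP {X} a.
Arguments adjP {X} a b.
Arguments goodl {X} a.
Arguments good {X} w.
Arguments pregood {X} w.
Arguments is_delta {X} a.

(* The free k-module on T; [monalg] provides the underlying abelian group, but
   its module structure requires a nontrivial scalar ring. *)
Definition freemod (k : pzRingType) (T : choiceType) : Type := {malg k[T]}.

(* Locked only to keep unification away from the finite-support encoding. *)
HB.lock Definition fbase (k : pzRingType) (T : choiceType) (t : T) :
  freemod k T := << t >>.

Section FreeModule.
Variables (k : pzRingType) (T : choiceType).
Local Notation fbase := (@fbase k T).

HB.instance Definition _ := GRing.Zmodule.on (freemod k T).

Definition fcoef (a : freemod k T) (t : T) : k := mcoeff t a.
Definition fsupp (a : freemod k T) : seq T := msupp a.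
Definition fscale (c : k) (a : freemod k T) : freemod k T :=
  \sum_(t <- fsupp a) << c * fcoef a t *g t >>.

Lemma fcoefD a b t : fcoef (a + b) t = fcoef a t + fcoef b t.
Proof. exact: mcoeffD. Qed.

Lemma fcoef0 t : fcoef 0 t = 0.
Proof. exact: mcoeff0. Qed.

Lemma fcoef_sum (I : Type) (r : seq I) (F : I -> freemod k T) t :
  fcoef (\sum_(i <- r) F i) t = \sum_(i <- r) fcoef (F i) t.
Proof.
by apply: (big_morph (fcoef^~ t)) => [a b|]; rewrite ?fcoefD ?fcoef0.
Qed.

Lemma fcoefU c s t : fcoef (<< c *g s >> : freemod k T) t = c *+ (s == t).
Proof. exact: mcoeffU. Qed.

Lemma fmodU (a : freemod k T) : a = \sum_(t <- fsupp a) << fcoef a t *g t >>.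
Proof. exact: monalgE. Qed.

Lemma fcoef_base s t : fcoef (fbase s) t = (s == t)%:R.
Proof. by rewrite unlock; exact: mcoeffU. Qed.

Lemma fmodP (a b : freemod k T) : fcoef a =1 fcoef b -> a = b.
Proof. by move=> ab; apply/malgP. Qed.

Lemma fcoef_out a t : t \notin fsupp a -> fcoef a t = 0.
Proof. exact: mcoeff_outdom. Qed.

Lemma fcoef_in a t : (t \in fsupp a) = (fcoef a t != 0).
Proof. by rewrite /fcoef mcoeff_neq0. Qed.

Lemma fscaleE c a t : fcoef (fscale c a) t = c * fcoef a t.
Proof.
rewrite [in RHS](fmodU a) /fscale !fcoef_sum mulr_sumr.
by apply: eq_bigr => s _; rewrite !fcoefU mulrnAr.
Qed.

Fact fscaleA c d a : fscale c (fscale d a) = fscale (c * d) a.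
Proof. by apply: fmodP => t; rewrite !fscaleE mulrA. Qed.
Fact fscale1 : left_id 1 fscale.
Proof. by move=> a; apply: fmodP => t; rewrite fscaleE mul1r. Qed.
Fact fscaleDr : right_distributive fscale +%R.
Proof. by move=> c a b; apply: fmodP => t; rewrite fcoefD !fscaleE fcoefD mulrDr. Qed.
Fact fscaleDl a : {morph fscale^~ a : c d / c + d}.
Proof. by move=> c d; apply: fmodP => t; rewrite fcoefD !fscaleE mulrDl. Qed.

HB.instance Definition _ := GRing.Zmodule_isLmodule.Build k (freemod k T)
  fscaleA fscale1 fscaleDr fscaleDl.

Lemma fcoefZ c (a : freemod k T) t : fcoef (c *: a) t = c * fcoef a t.
Proof. exact: fscaleE. Qed.

End FreeModule.

HB.lock Definition lext (k : pzRingType) (T : choiceType) (V : lmodType k)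
    (f : T -> V) (a : freemod k T) : V :=
  \sum_(t <- fsupp a) fcoef a t *: f t.

Section FreeModuleTheory.
Variables (k : pzRingType) (T : choiceType).
Local Notation fbase := (@fbase k T).

Lemma lextE (V : lmodType k) (f : T -> V) a :
  lext f a = \sum_(t <- fsupp a) fcoef a t *: f t.
Proof. by rewrite unlock. Qed.

Section Lext.
Variables (V : lmodType k) (f : T -> V).

Lemma lextEw (s : seq T) a : uniq s -> {subset fsupp a <= s} ->
  lext f a = \sum_(t <- s) fcoef a t *: f t.
Proof.
move=> us sub; rewrite lextE.
rewrite [RHS](bigID (mem (fsupp a))) /= [X in _ + X]big1 ?addr0; last first.
  by move=> t /fcoef_out ->; rewrite scale0r.
rewrite -[RHS]big_filter; apply/perm_big/uniq_perm; rewrite ?filter_uniq ?fset_uniq //.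
move=> t; rewrite mem_filter /=; have [ta|//] := boolP (t \in fsupp a).
by rewrite (sub _ ta).
Qed.

Lemma lext_is_linear : linear (lext f).
Proof.
move=> c a b; set s := undup (fsupp (c *: a + b) ++ fsupp a ++ fsupp b).
have us : uniq s by exact: undup_uniq.
rewrite !(@lextEw s) //; try by move=> t ts; rewrite mem_undup !mem_cat ts ?orbT.
rewrite scaler_sumr -big_split; apply: eq_bigr => t _ /=.
by rewrite fcoefD fcoefZ scalerDl scalerA.
Qed.

HB.instance Definition _ :=
  GRing.isLinear.Build k (freemod k T) V *:%R (lext f) lext_is_linear.

Lemma lext_base t : lext f (fbase t) = f t.
Proof.
rewrite (@lextEw [:: t]) //; first by rewrite big_seq1 fcoef_base eqxx scale1r.
move=> s; rewrite fcoef_in fcoef_base inE [t == s]eq_sym.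
by case: (s == t) => //; rewrite eqxx.
Qed.
End Lext.

Lemma fmodE (a : freemod k T) : a = \sum_(t <- fsupp a) fcoef a t *: fbase t.
Proof.
apply: fmodP => s.
rewrite [in LHS](fmodU a) !fcoef_sum; apply: eq_bigr => t _.
by rewrite fcoefU fcoefZ fcoef_base mulr_natr.
Qed.

Lemma eq_linear_base (V : lmodType k) (f g : {linear freemod k T -> V}) :
  (forall t, f (fbase t) = g (fbase t)) -> f =1 g.
Proof.
move=> fg a; rewrite (fmodE a) !linear_sum; apply: eq_bigr => t _.
by rewrite !linearZ fg.
Qed.

Definition supp_in (S : T -> Prop) (a : freemod k T) : Prop :=
  forall t, t \in fsupp a -> S t.

Lemma supp_inD S a b : supp_in S a -> supp_in S b -> supp_in S (a + b).
Proof.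
move=> Sa Sb t; rewrite fcoef_in fcoefD.
have [/Sa //|/fcoef_out ->] := boolP (t \in fsupp a).
by rewrite add0r -fcoef_in => /Sb.
Qed.

Lemma supp_inZ S c a : supp_in S a -> supp_in S (c *: a).
Proof.
move=> Sa t; rewrite fcoef_in fcoefZ.
by have [/Sa //|/fcoef_out ->] := boolP (t \in fsupp a); rewrite mulr0 eqxx.
Qed.

Lemma supp_in0 S : supp_in S 0.
Proof. by move=> t; rewrite fcoef_in fcoef0 eqxx. Qed.

Lemma supp_in_base (S : T -> Prop) t : S t -> supp_in S (fbase t).
Proof.
by move=> St s; rewrite fcoef_in fcoef_base; have [<-|_] := eqVneq t s; rewrite ?eqxx.
Qed.

End FreeModuleTheory.

Lemma supp_in_lext (k : pzRingType) (T U : choiceType) (S : T -> Prop)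
    (S' : U -> Prop) (f : T -> freemod k U) a :
  supp_in S a -> (forall t, S t -> supp_in S' (f t)) -> supp_in S' (lext f a).
Proof.
move=> Sa Sf; rewrite lextE big_seq.
apply: (@big_ind _ (supp_in S')) => [|? ? ? ?|t ta].
- exact: supp_in0.
- exact: supp_inD.
- by apply: supp_inZ; apply: Sf; apply: Sa.
Qed.

Definition bext (k : pzRingType) (T U : choiceType) (V : lmodType k)
    (f : T -> U -> V) (a : freemod k T) (b : freemod k U) : V :=
  lext (fun t => lext (f t) b) a.

Lemma fmod_ind (k : pzRingType) (T : choiceType) (Q : freemod k T -> Prop) :
  Q 0 -> (forall c a b, Q a -> Q b -> Q (c *: a + b)) ->
  (forall t, Q (fbase k t)) -> forall a, Q a.
Proof.
move=> Q0 QD Qb a; rewrite (fmodE a).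
elim: (fsupp a) => [|t s IH]; first by rewrite big_nil.
by rewrite big_cons; apply: QD.
Qed.

Section BilinearExtension.
Variables (k : comPzRingType) (T U : choiceType) (V : lmodType k).
Variable f : T -> U -> V.

Lemma bext_linearl b : linear ((bext f)^~ b).
Proof. exact: lext_is_linear. Qed.

Lemma bext_linearr a : linear (bext f a).
Proof.
move=> c b b'; rewrite /bext !lextE scaler_sumr -big_split /=.
apply: eq_bigr => t _; rewrite linearP scalerDr !scalerA.
by rewrite [c * _]mulrC.
Qed.

Lemma bext_base t u : bext f (fbase k t) (fbase k u) = f t u.
Proof. by rewrite /bext !lext_base. Qed.

Lemma bext0l b : bext f 0 b = 0. Proof. by rewrite /bext linear0. Qed.
Lemma bext0r a : bext f a 0 = 0.
Proof. by have := bext_linearr a (-1) 0 0; rewrite scaler0 addr0 scaleN1r addNr. Qed.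
Lemma bextDl a a' b : bext f (a + a') b = bext f a b + bext f a' b.
Proof. by have := bext_linearl b 1 a a'; rewrite !scale1r. Qed.
Lemma bextDr a b b' : bext f a (b + b') = bext f a b + bext f a b'.
Proof. by have := bext_linearr a 1 b b'; rewrite !scale1r. Qed.
Lemma bextZl c a b : bext f (c *: a) b = c *: bext f a b.
Proof. by have := bext_linearl b c a 0; rewrite !addr0 bext0l addr0. Qed.
Lemma bextZr c a b : bext f a (c *: b) = c *: bext f a b.
Proof. by have := bext_linearr a c b 0; rewrite !addr0 bext0r addr0. Qed.
End BilinearExtension.

Section Operations.
Variables (k : comPzRingType) (lam : k) (X : choiceType).
Local Notation word := (word X).
Local Notation kword := (freemod k (seq (letter X))).
Local Notation base := (@fbase k (seq (letter X))).
Implicit Types (a b : letter X) (u v w : word) (s t : kword).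

Definition kcat : kword -> kword -> kword := bext (fun u v => base (u ++ v)).
Definition kP : kword -> kword := lext (fun w => base [:: LP w]).

(* Expanding the recursion for d_X down to single letters: [d_word_cat] is the
   product rule for an arbitrary factorization of a word. *)
Definition d_letters (dl : letter X -> kword) : word -> kword :=
  fix d w := if w is a :: w' then
      kcat (dl a) (base w') + kcat (base [:: a]) (d w')
      + lam *: kcat (dl a) (d w')
    else 0.

Fixpoint d_letter (a : letter X) : kword :=
  if a is LP w then kP (d_letters d_letter w) else base [:: LD [:: a]].

Definition d_word : word -> kword := d_letters d_letter.

(* For nonempty words u, v with standard decompositions u_1 ... u_m and
   v_1 ... v_n, the factor u_m <> v_1 differs from the concatenation u_m v_1
   only if both are of the form P(_), i.e. if the last letter of u and the first
   letter of v are.  Recursion is on a bound for dep_P(u) + dep_P(v). *)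
Definition dia_letter (rec : word -> word -> kword) (a b : letter X) : kword :=
  match a, b with
  | LP u, LP v => kP (rec u [:: LP v]) + kP (rec [:: LP u] v) + lam *: kP (rec u v)
  | _, _ => base [:: a; b]
  end.

Definition dia_step (rec : word -> word -> kword) (u v : word) : kword :=
  match rev u, v with
  | a :: ru, b :: v' => kcat (kcat (base (rev ru)) (dia_letter rec a b)) (base v')
  | _, _ => base (u ++ v)
  end.

Fixpoint dia_rec (n : nat) (u v : word) : kword :=
  if n is m.+1 then dia_step (dia_rec m) u v else base (u ++ v).

Definition dia_word (u v : word) : kword := dia_rec (wdepth u + wdepth v) u v.

Lemma kcat_base u v : kcat (base u) (base v) = base (u ++ v).
Proof. exact: bext_base. Qed.

Lemma kcat0l s : kcat 0 s = 0. Proof. exact: bext0l. Qed.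
Lemma kcat0r s : kcat s 0 = 0. Proof. exact: bext0r. Qed.
Lemma kcatDl r s t : kcat (r + s) t = kcat r t + kcat s t.
Proof. exact: bextDl. Qed.
Lemma kcatDr r s t : kcat r (s + t) = kcat r s + kcat r t.
Proof. exact: bextDr. Qed.
Lemma kcatZl c s t : kcat (c *: s) t = c *: kcat s t.
Proof. exact: bextZl. Qed.
Lemma kcatZr c s t : kcat s (c *: t) = c *: kcat s t.
Proof. exact: bextZr. Qed.
Definition kcatE := (kcat0l, kcat0r, kcatDl, kcatDr, kcatZl, kcatZr).

Lemma kcatA : associative kcat.
Proof.
move=> r s t.
elim/fmod_ind: r => [|c r r' IH IH'|u]; rewrite ?kcatE ?IH ?IH' //.
elim/fmod_ind: s => [|c s s' IH IH'|v]; rewrite ?kcatE ?IH ?IH' //.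
elim/fmod_ind: t => [|c t t' IH IH'|w]; rewrite ?kcatE ?IH ?IH' //.
by rewrite !kcat_base catA.
Qed.

Lemma kcat1l : left_id (base [::]) kcat.
Proof.
move=> s; elim/fmod_ind: s => [|c s s' IH IH'|v]; rewrite ?kcatE ?IH ?IH' //.
by rewrite kcat_base.
Qed.

Lemma kcat1r : right_id (base [::]) kcat.
Proof.
move=> s; elim/fmod_ind: s => [|c s s' IH IH'|v]; rewrite ?kcatE ?IH ?IH' //.
by rewrite kcat_base cats0.
Qed.

Lemma d_letterP w : d_letter (LP w) = kP (d_word w). Proof. by []. Qed.

Lemma d_letter_Delta a : is_delta a -> d_letter a = base [:: LD [:: a]].
Proof. by case: a. Qed.

Lemma d_word_cons a w : d_word (a :: w) =
  kcat (d_letter a) (base w) + kcat (base [:: a]) (d_word w)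
  + lam *: kcat (d_letter a) (d_word w).
Proof. by []. Qed.

Lemma d_word1 a : d_word [:: a] = d_letter a.
Proof. by rewrite d_word_cons !kcatE scaler0 !addr0 kcat1r. Qed.

Lemma d_word_cat u v : d_word (u ++ v) =
  kcat (d_word u) (base v) + kcat (base u) (d_word v)
  + lam *: kcat (d_word u) (d_word v).
Proof.
elim: u => [|a u IH].
  by rewrite kcat1l !kcatE scaler0 add0r addr0.
rewrite cat_cons !d_word_cons IH -!kcat_base -[base (a :: u)](kcat_base [:: a]).
rewrite !(kcatE, scalerDr, kcatA) -!addrA.
have AC (V : zmodType) (A B C D E F G : V) :
    A + (B + (C + (D + (E + (F + G))))) = A + (B + (E + (C + (F + (D + G))))).
  congr (_ + (_ + _)); rewrite [RHS]addrCA; congr (_ + _).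
  by rewrite [LHS]addrCA; congr (_ + _); rewrite addrCA.
exact: AC.
Qed.

Lemma rev_rcons_dia rec u a b v : dia_step rec (rcons u a) (b :: v) =
  kcat (kcat (base u) (dia_letter rec a b)) (base v).
Proof. by rewrite /dia_step rev_rcons revK. Qed.

Lemma dia_step0l rec v : dia_step rec [::] v = base v. Proof. by []. Qed.
Lemma dia_step0r rec u : dia_step rec u [::] = base u.
Proof. by rewrite /dia_step cats0; case: (rev u). Qed.

Lemma dia_rec_nP n u v : wdepth u = 0%N \/ wdepth v = 0%N ->
  dia_rec n u v = base (u ++ v).
Proof.
case: n => // n d0 /=; case: v d0 => [|b v] d0; first by rewrite dia_step0r cats0.
case/lastP: u d0 => [|u a] d0 //; rewrite rev_rcons_dia.
have -> : dia_letter (dia_rec n) a b = base [:: a; b].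
  case: d0; case: a => //= w; case: b => //= z.
    by rewrite -cats1 wdepth_cat /= maxn0 => /eqP; rewrite -leqn0 geq_max ltn0 andbF.
  by move=> /eqP; rewrite -leqn0 geq_max ltn0.
by rewrite !kcat_base -cats1 -!catA.
Qed.

Lemma dia_rec_stable n m u v : (wdepth u + wdepth v <= n)%N ->
  (wdepth u + wdepth v <= m)%N -> dia_rec n u v = dia_rec m u v.
Proof.
elim: n m u v => [|n IH] m u v.
  rewrite leqn0 addn_eq0 => /andP[/eqP du _] _.
  by rewrite !dia_rec_nP //; left.
case: m => [|m].
  rewrite leqn0 addn_eq0 => _ /andP[/eqP du _].
  by rewrite !dia_rec_nP //; left.
case/lastP: u => [|u a]; first by rewrite /= !dia_step0l.
case: v => [|b v]; first by rewrite /= !dia_step0r.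
rewrite /= -cats1 wdepth_cat -/(wdepth v) cats1 => dn dm.
rewrite !rev_rcons_dia; congr (kcat (kcat _ _) _).
case: a dn dm => //= w; case: b => //= z dn dm.
rewrite -!/(wdepth _) in dn dm.
have aux p q x y N : (maxn p x.+1 + maxn y.+1 q <= N.+1 -> x + y < N)%N.
  move=> H; have := leq_trans (leq_add (leq_maxr p x.+1) (leq_maxl y.+1 q)) H.
  by rewrite addSn addnS ltnS.
rewrite !maxn0 in dn dm; have {}dn := aux _ _ _ _ _ dn; have {}dm := aux _ _ _ _ _ dm.
have dP (y : word) : wdepth [:: LP y] = (wdepth y).+1 by rewrite /= maxn0.
congr (kP _ + kP _ + lam *: kP _); apply: IH; rewrite ?dP ?addnS ?addSn //; exact: ltnW.
Qed.

Lemma dia_word_rec n u v : (wdepth u + wdepth v <= n)%N ->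
  dia_word u v = dia_rec n u v.
Proof. exact: dia_rec_stable. Qed.

Lemma dia_letter_nP rec a b : ~~ (isP a && isP b) ->
  dia_letter rec a b = base [:: a; b].
Proof. by case: a b => // w; case. Qed.

Lemma dia_word_PP u v : dia_word [:: LP u] [:: LP v] =
  kP (dia_word u [:: LP v]) + kP (dia_word [:: LP u] v) + lam *: kP (dia_word u v).
Proof.
have dP (y : word) : wdepth [:: LP y] = (wdepth y).+1 by rewrite /= maxn0.
pose n := (wdepth u + wdepth v).+1.
rewrite (@dia_word_rec n.+1) ?dP ?addSn ?addnS //.
rewrite !(@dia_word_rec n) ?dP ?addSn ?addnS //.
by rewrite /= /dia_step /= kcat1l kcat1r.
Qed.

Lemma dia_word_nP u a b v : ~~ (isP a && isP b) ->
  dia_word (rcons u a) (b :: v) = base (rcons u a ++ b :: v).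
Proof.
move=> ab; rewrite (@dia_word_rec (wdepth (rcons u a) + wdepth (b :: v)).+1) //=.
by rewrite rev_rcons_dia dia_letter_nP // !kcat_base -cats1 -!catA.
Qed.

Lemma dia_word_cat u1 u2 v1 v2 : u2 != [::] -> v1 != [::] ->
  dia_word (u1 ++ u2) (v1 ++ v2) = kcat (kcat (base u1) (dia_word u2 v1)) (base v2).
Proof.
case/lastP: u2 => // u2 a _; case: v1 => // b v1 _.
pose n := (wdepth (u1 ++ rcons u2 a) + wdepth ((b :: v1) ++ v2))%N.
rewrite (@dia_word_rec n.+1) //= (@dia_word_rec n.+1).
  rewrite /= -rcons_cat !rev_rcons_dia -!kcat_base.
  by rewrite !kcatA.
apply/leqW; apply: leq_add; rewrite wdepth_cat; first exact: leq_maxr.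
exact: leq_maxl.
Qed.

Lemma dia_word_X0 u v : X0 u -> X0 v -> dia_word u v = base (u ++ v).
Proof.
by move=> /X0P/andP[_ /wdepth_delta du] _; rewrite /dia_word dia_rec_nP //; left.
Qed.

Lemma supp_kcat (S S' S'' : word -> Prop) s t : supp_in S s -> supp_in S' t ->
  (forall u v, S u -> S' v -> S'' (u ++ v)) -> supp_in S'' (kcat s t).
Proof.
move=> Ss St H; rewrite /kcat /bext; apply: supp_in_lext Ss _ => u Su.
by apply: supp_in_lext St _ => v Sv; apply: supp_in_base; apply: H.
Qed.

Lemma adj_sorted u v : map isP u = map isP v -> sorted adjP u = sorted adjP v.
Proof.
suff H (w : word) : sorted adjP w = sorted (fun x y => ~~ (x && y)) (map isP w).
  by rewrite !H => ->.
by rewrite sorted_map.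
Qed.

Definition same_shape w : word -> Prop :=
  fun v => all goodl v /\ map isP v = map isP w.

Lemma d_word_supp w : all goodl w -> supp_in (same_shape w) (d_word w).
Proof.
pose Q a := goodl a -> supp_in (same_shape [:: a]) (d_letter a).
pose Qs w := all goodl w -> supp_in (same_shape w) (d_word w).
have QG x : Q (Gen x) by move=> _; apply: supp_in_base.
have QD u : Qs u -> Q (LD u).
  move=> _ gu; rewrite d_letter_Delta //; apply: supp_in_base; split=> //=.
  by rewrite andbT; apply: gu.
have QP u : Qs u -> Q (LP u).
  move=> Qu; rewrite /Q goodlP d_letterP => /andP[u0 /andP[gu su]].
  apply: supp_in_lext (Qu gu) _ => v [gv ev]; apply: supp_in_base.
  split=> //=; rewrite andbT -/(goodl (LP v)) goodlP /good /pregood gv.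
  rewrite (adj_sorted ev) su !andbT.
  by rewrite -size_eq0 -(size_map isP) ev size_map size_eq0.
have Q0 : Qs [::] by move=> _; exact: supp_in0.
have QS a u : Q a -> Qs u -> Qs (a :: u).
  move=> Qa Qu /andP[/[dup] ga /Qa sa /[dup] gu /Qu su]; rewrite d_word_cons.
  have glue x y : same_shape [:: a] x -> same_shape u y -> same_shape (a :: u) (x ++ y).
    by move=> [gx ex] [gy ey]; split; rewrite ?all_cat ?gx // map_cat ex ey.
  have ba : supp_in (same_shape [:: a]) (base [:: a]).
    by apply: supp_in_base; split; rewrite //= ga.
  have bu : supp_in (same_shape u) (base u) by apply: supp_in_base.
  apply: supp_inD; first apply: supp_inD; last apply: supp_inZ.
  - exact: supp_kcat sa bu glue.
  - exact: supp_kcat ba su glue.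
  - exact: supp_kcat sa su glue.
exact: word_letter_ind QG QD QP Q0 QS w.
Qed.

Lemma d_word_good w : good w -> supp_in good (d_word w).
Proof.
case/andP=> w0 /andP[gw sw] v /(d_word_supp gw)[gv ev].
rewrite /good /pregood gv (adj_sorted ev) sw !andbT.
by rewrite -size_eq0 -(size_map isP) ev size_map size_eq0.
Qed.

Lemma pregood_cat u a b v : pregood (rcons u a ++ b :: v) =
  [&& pregood (rcons u a), pregood (b :: v) & adjP a b].
Proof.
elim: u => [|c u IH].
  by rewrite /= !pregood_cons /= !andbT; do !bool_congr.
move: IH; set V := pregood (b :: v) => IH; rewrite !rcons_cons cat_cons !pregood_cons IH.
have -> : rcons u a ++ b :: v = head a u :: behead (rcons u a ++ b :: v) by case: (u).
have -> : (if rcons u a is e :: _ then adjP c e else true) = adjP c (head a u).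
  by case: (u).
by case: (goodl c); case: (pregood (rcons u a)); case: (V); case: (adjP a b); rewrite ?andbF ?andbT.
Qed.

Lemma pregood_replace u y z : pregood (rcons u (LP y)) -> good z ->
  pregood (rcons u (LP z)).
Proof.
rewrite /pregood !all_rcons => /andP[/andP[_ gu] su] gz.
rewrite goodlP gz gu /= (@adj_sorted _ (rcons u (LP y))) //.
by rewrite !map_rcons.
Qed.

Lemma dia_rec_good n u v : (wdepth u + wdepth v <= n)%N ->
  good u -> good v -> supp_in good (dia_rec n u v).
Proof.
elim: n u v => [|n IH] u v.
  rewrite leqn0 addn_eq0 => /andP[/eqP du _] /andP[u0 gu] /andP[v0 gv].
  rewrite dia_rec_nP; last by left.
  apply: supp_in_base; rewrite /good; case/lastP: u u0 gu du => // u a _ gu du.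
  case: v v0 gv => // b v _ gv; rewrite pregood_cat gu gv.
  have : isP a = false.
    case: a du {gu} => // w; rewrite -cats1 wdepth_cat /= maxn0 => /eqP.
    by rewrite -leqn0 geq_max ltn0 andbF.
  by rewrite /adjP => ->; case: (rcons u a).
case/lastP: u => [|u a]; first by [].
case: v => [|b v]; first by [].
move=> dn gu gv; rewrite /= rev_rcons_dia.
have [ab|] := boolP (adjP a b).
  rewrite dia_letter_nP // !kcat_base; apply: supp_in_base.
  rewrite -[u ++ _]cat_rcons -catA cat1s /good.
  case/andP: gu => _ gu; case/andP: gv => _ gv.
  by rewrite pregood_cat gu gv ab; case: (u).
rewrite negbK; case: a dn gu => // w dn gu; case: b dn gv => // z dn gv _.
have dP (y : word) : wdepth [:: LP y] = (wdepth y).+1 by rewrite /= maxn0.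
have {}dn : (wdepth w + wdepth z < n)%N.
  move: dn; rewrite -cats1 wdepth_cat dP wdepth_cons -[ldepth _]/((wdepth z).+1) => H.
  have := leq_trans (leq_add (leq_maxr _ _) (leq_maxl _ _)) H.
  by rewrite addSn addnS ltnS.
have gw : good w.
  by case/andP: gu => _ /andP[+ _]; rewrite all_rcons goodlP => /andP[].
have gz : good z by case/andP: gv => _ /andP[/andP[+ _] _]; rewrite -/(goodl (LP z)) goodlP.
have gP (y : word) : good y -> good [:: LP y].
  by move=> gy; rewrite /good /pregood /= andbT -/(goodl (LP y)) goodlP gy.
pose S (x : word) := exists2 y : word, good y & x = [:: LP y].
have SP s : supp_in good s -> supp_in S (kP s).
  by move=> Ss; apply: supp_in_lext Ss _ => y gy; apply: supp_in_base; exists y.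
have SX : supp_in S (dia_letter (dia_rec n) (LP w) (LP z)).
  apply: supp_inD; first apply: supp_inD; last apply: supp_inZ.
  - by apply/SP/IH; rewrite ?dP ?addnS //; apply: gP.
  - by apply/SP/IH; rewrite ?dP ?addSn //; apply: gP.
  - by apply/SP/IH => //; apply: ltnW.
apply: (@supp_kcat (fun x : word => exists2 y : word, good y & x = rcons u (LP y)) (eq v)).
- apply: (@supp_kcat (eq u) S) => //; first exact: supp_in_base.
  by move=> _ _ <- [y gy ->]; exists y; rewrite // cats1.
- exact: supp_in_base.
move=> _ _ [y gy ->] <-; rewrite /good -size_eq0 size_cat size_rcons addSn /=.
have guy : pregood (rcons u (LP y)) by case/andP: gu => _ /pregood_replace; apply.
case/andP: gv => _; rewrite pregood_cons => /and3P[_ gv hv].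
case: v gv hv => [|c v] gv hv; first by rewrite cats0.
by rewrite pregood_cat guy gv.
Qed.

Lemma dia_word_good u v : good u -> good v -> supp_in good (dia_word u v).
Proof. exact: dia_rec_good. Qed.

End Operations.

Definition kXinf (k : pzRingType) (X : choiceType) : Type :=
  freemod k (set_type (Xinf X)).
HB.instance Definition _ (k : pzRingType) (X : choiceType) :=
  GRing.Lmodule.on (kXinf k X).

Section XinfOperations.
Variables (k : comPzRingType) (lam : k) (X : choiceType).
Local Notation XI := (set_type (Xinf X)).
Local Notation kX := (kXinf k X).
Local Notation kword := (freemod k (seq (letter X))).

Definition Xword (w : word X) (gw : good w) : XI :=
  exist _ w (introT idP (etrans (in_Xinf w) gw)).

(* Inclusion of k X_infty in the free module on all words, and its retraction
   killing the words outside [Xinf].  The retraction is only applied to elements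
   already supported in [Xinf] (see [d_word_good] and [dia_word_good]). *)
Definition incl : kX -> kword := lext (fun u : XI => fbase k (val u)).
Definition restr : kword -> kX :=
  lext (fun w => if insub w is Some u then fbase k (u : XI) else 0).

Definition PX : kX -> kX :=
  lext (fun u : XI => restr (fbase k [:: LP (val u)])).
Definition dX : kX -> kX := lext (fun u : XI => restr (d_word lam (val u))).
Definition diaX : kX -> kX -> kX :=
  bext (fun u v : XI => restr (dia_word lam (val u) (val v))).

Definition jX (x : X) : kX := fbase k (@Xword [:: Gen x] isT).

Lemma incl_linear : linear incl.
Proof. exact: lext_is_linear. Qed.
HB.instance Definition _ :=
  GRing.isLinear.Build k kX kword *:%R incl incl_linear.
Lemma restr_linear : linear restr.
Proof. exact: lext_is_linear. Qed.
HB.instance Definition _ :=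
  GRing.isLinear.Build k kword kX *:%R restr restr_linear.

Lemma incl_base (u : XI) : incl (fbase k u) = fbase k (val u).
Proof. exact: lext_base. Qed.

Lemma restr_base (u : XI) : restr (fbase k (val u)) = fbase k u.
Proof. by rewrite /restr lext_base valK. Qed.

Lemma inclK : cancel incl restr.
Proof.
move=> a; elim/fmod_ind: a => [|c a b IHa IHb|u]; first by rewrite !linear0.
  by rewrite incl_linear restr_linear IHa IHb.
by rewrite incl_base restr_base.
Qed.

Lemma restrK (s : kword) : supp_in (fun w => good w) s -> incl (restr s) = s.
Proof.
move=> gs; rewrite [in LHS](fmodE s) [RHS](fmodE s) !linear_sum.
rewrite big_seq [RHS]big_seq; apply: eq_bigr => w /gs gw.
have e : incl (restr (fbase k w)) = fbase k w.
  by rewrite -[w]/(val (Xword gw)) restr_base incl_base.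
by rewrite !linearZ -[in RHS]e.
Qed.

Lemma incl_PX (u : XI) : incl (PX (fbase k u)) = fbase k [:: LP (val u)].
Proof.
rewrite /PX lext_base restrK //; apply: supp_in_base.
have := valP u; rewrite in_Xinf => gu.
by rewrite /good /pregood /= -/(goodl (LP (val u))) goodlP gu.
Qed.

Lemma incl_dX (u : XI) : incl (dX (fbase k u)) = d_word lam (val u).
Proof.
rewrite /dX lext_base restrK //; apply: d_word_good.
by rewrite -in_Xinf; apply: valP.
Qed.

Lemma incl_diaX (u v : XI) :
  incl (diaX (fbase k u) (fbase k v)) = dia_word lam (val u) (val v).
Proof.
rewrite /diaX bext_base restrK //.
by apply: dia_word_good; rewrite -in_Xinf; apply: valP.
Qed.

End XinfOperations.
Arguments PX k X a : clear implicits.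
Arguments jX k X x : clear implicits.

(* Algebras are associative but need not have an identity: [kXinf] is spanned by
   nonempty words, hence has no identity in general.  Whenever an identity
   exists, a differential operator is required to kill it. *)
Section ParaDifferentialRotaBaxter.
Variables (k : comPzRingType) (lam : k).

Record is_algebra (A : lmodType k) (mul : A -> A -> A) : Prop := {
  alg_assoc : associative mul;
  alg_linearl : forall y, linear (mul^~ y);
  alg_linearr : forall x, linear (mul x)
}.

Record is_differential (A : lmodType k) (mul : A -> A -> A) (d : A -> A) : Prop := {
  diff_linear : linear d;
  diff_mul : forall x y,
    d (mul x y) = mul (d x) y + mul x (d y) + lam *: mul (d x) (d y);
  diff_one : forall e, left_id e mul -> right_id e mul -> d e = 0
}.

Record is_Rota_Baxter (A : lmodType k) (mul : A -> A -> A) (P : A -> A) : Prop := {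
  RB_linear : linear P;
  RB_mul : forall x y,
    mul (P x) (P y) = P (mul (P x) y) + P (mul x (P y)) + lam *: P (mul x y)
}.

Inductive pdRB_type := type_I | type_II.

Definition weight_of_type (t : pdRB_type) : Prop :=
  match t with type_I => lam = 0 | type_II => lam <> 0 end.

Record is_pdRB (t : pdRB_type) (A : lmodType k) (mul : A -> A -> A)
    (d P : A -> A) : Prop := {
  pdRB_weight : weight_of_type t;
  pdRB_algebra : is_algebra mul;
  pdRB_diff : is_differential mul d;
  pdRB_RB : is_Rota_Baxter mul P;
  pdRB_comm : forall x, d (P x) = P (d x)
}.

Definition is_algebra_hom (A B : lmodType k) (mulA : A -> A -> A)
    (mulB : B -> B -> B) (f : A -> B) : Prop :=
  linear f /\ forall x y, f (mulA x y) = mulB (f x) (f y).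

Definition is_free_pdRB (t : pdRB_type) (X : Type) (A : lmodType k)
    (mul : A -> A -> A) (d P : A -> A) (j : X -> A) : Prop :=
  is_pdRB t mul d P /\
  forall (R : lmodType k) (mulR : R -> R -> R) (dR PR : R -> R),
    is_pdRB t mulR dR PR ->
    forall f : X -> R, exists! fbar : A -> R,
      [/\ is_algebra_hom mul mulR fbar,
          forall a, fbar (d a) = dR (fbar a),
          forall a, fbar (P a) = PR (fbar a)
        & forall x, fbar (j x) = f x].

End ParaDifferentialRotaBaxter.

(* Main.v *)
Require Import Defs.
From mathcomp Require Import all_boot all_algebra.
From mathcomp Require Import boolp zify.

Set Implicit Arguments.
Unset Strict Implicit.
Unset Printing Implicit Defensive.

Import GRing.Theory.
Local Open Scope ring_scope.

(** The product, the derivation and P make sense on the free module on all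
bracketed words, including the empty word and words with adjacent P-letters.
There the empty word is a unit, the product of two words is their
concatenation except where two P-letters meet, and every identity to be proved
is an identity in that larger algebra; it is then pulled back along the
injection [incl] of k X_infty, which commutes with all three operations.

Concatenating on the outside of a product changes nothing at the junction
([dia_catl], [dia_catr]).  Hence associativity and the Leibniz rule for words
reduce to the same statements for the letters that meet.  If some of these
letters are not of the form P(u), the product involved is a concatenation and
the statement follows from associativity of concatenation, or from the Leibniz
rule for concatenation.  If all letters are of the form P(u), the Rota-Baxter
identity, which holds by construction of the product ([kP_RB]), expresses the
statement through instances with fewer occurrences of P: this is the formal
content of [assoc_PPP] and [leibniz_PP], and the proofs are inductions on
depth.

Freeness: a map f from X to an algebra R extends to words letter by letter
([ev_word]).  This evaluation sends concatenation to multiplication, so it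
commutes with the derivation by construction of the latter, and it is
multiplicative for the product on words by the induction used for the Leibniz
rule, now using the Rota-Baxter identity of R ([ev_dia_word]).  It is the only
choice because a word of X_infty is built from generators by the product, the
derivation and P ([hom_restr]).

An identity element can only exist in the zero module: a product with a
generator on the right has all its words of length at least two, so it is
never that generator unless 1 = 0 in k ([dX_one]). *)

(** * Linear and bilinear maps on free modules *)

Section LinearMaps.
Variable k : comPzRingType.
Implicit Types A B C D E : lmodType k.

Lemma linear_comb A B (f : A -> B) : linear f ->
  [/\ f 0 = 0, {morph f : x y / x + y} & forall c, {morph f : x / c *: x}].
Proof.
move=> lf; have fD x y : f (x + y) = f x + f y.
  by have := lf 1 x y; rewrite !scale1r.
have f0 : f 0 = 0 by apply: (@addrI _ (f 0)); rewrite -fD !addr0.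
by split=> // c x; have := lf c x 0; rewrite f0 !addr0.
Qed.

Lemma linear_id A : linear (@id A). Proof. by []. Qed.

Definition bilin A B C (f : A -> B -> C) :=
  (forall y, linear (f^~ y)) /\ (forall x, linear (f x)).

Lemma bilinE A B C (f : A -> B -> C) : bilin f ->
  [/\ forall x y z, f (x + y) z = f x z + f y z,
      forall x y z, f x (y + z) = f x y + f x z,
      forall c x y, f (c *: x) y = c *: f x y
    & forall c x y, f x (c *: y) = c *: f x y].
Proof.
move=> [fl fr]; split=> [x y z|x y z|c x y|c x y].
- by have [_ -> _] := linear_comb (fl z).
- by have [_ -> _] := linear_comb (fr x).
- by have [_ _ ->] := linear_comb (fl y).
- by have [_ _ ->] := linear_comb (fr x).
Qed.

Lemma bilinD A B C (f g : A -> B -> C) : bilin f -> bilin g ->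
  bilin (fun x y => f x y + g x y).
Proof.
move=> [fl fr] [gl gr]; split=> [z|z] c x y /=.
  by rewrite (fl z) (gl z) scalerDr addrACA.
by rewrite (fr z) (gr z) scalerDr addrACA.
Qed.

Lemma bilinZ A B C (f : A -> B -> C) c : bilin f ->
  bilin (fun x y => c *: f x y).
Proof.
move=> [fl fr]; split=> [z|z] e x y /=.
  by rewrite (fl z) scalerDr !scalerA mulrC.
by rewrite (fr z) scalerDr !scalerA mulrC.
Qed.

Lemma bilin_pre A B C D E (f : A -> B -> C) (g : D -> A) (h : E -> B) :
  bilin f -> linear g -> linear h -> bilin (fun x y => f (g x) (h y)).
Proof.
move=> [fl fr] lg lh; split=> [z|z] c x y /=; first by rewrite lg (fl (h z)).
by rewrite lh (fr (g z)).
Qed.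

Lemma bilin_post A B C D (f : A -> B -> C) (g : C -> D) :
  bilin f -> linear g -> bilin (fun x y => g (f x y)).
Proof.
by move=> [fl fr] lg; split=> [z|z] c x y /=; rewrite ?(fl z) ?(fr z) lg.
Qed.

Lemma eq_bilin_base (T U : choiceType) (V : lmodType k)
    (f g : freemod k T -> freemod k U -> V) : bilin f -> bilin g ->
  (forall t u, f (fbase k t) (fbase k u) = g (fbase k t) (fbase k u)) -> f =2 g.
Proof.
move=> [fl fr] [gl gr] fg s t.
elim/fmod_ind: s => [|c s s' IHs IHs'|u].
- by have [-> _ _] := linear_comb (fl t); have [-> _ _] := linear_comb (gl t).
- by rewrite (fl t) (gl t) IHs IHs'.
elim/fmod_ind: t => [|c t t' IHt IHt'|v]; last exact: fg.
- have [-> _ _] := linear_comb (fr (fbase k u)).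
  by have [-> _ _] := linear_comb (gr (fbase k u)).
- by rewrite fr gr IHt IHt'.
Qed.

Lemma eq_linear_on_supp (T : choiceType) (V : lmodType k) (S : T -> Prop)
    (f g : freemod k T -> V) a : linear f -> linear g ->
  (forall t, S t -> f (fbase k t) = g (fbase k t)) -> supp_in S a -> f a = g a.
Proof.
move=> lf lg fg Sa.
have [[f0 fD fZ] [g0 gD gZ]] := (linear_comb lf, linear_comb lg).
rewrite (fmodE a) big_seq; apply: (big_ind (fun x => f x = g x)).
- by rewrite f0 g0.
- by move=> x y fx fy; rewrite fD gD fx fy.
- by move=> t /Sa St; rewrite fZ gZ fg.
Qed.

End LinearMaps.

(** * Identities of weight lambda *)

Section WeightedIdentities.
Variables (k : comPzRingType) (lam : k).

Lemma addr_zip3 (V : zmodType) (a b c d e f : V) :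
  (a + b + c) + (d + e + f) = (a + d) + (b + e) + (c + f).
Proof. by rewrite addrACA [a + b + _]addrACA. Qed.

(** The seven terms of a ternary expansion of weight lambda are indexed by the
nonempty subsets of its three factors; the two ways of bracketing a triple
product group them by membership of the first or of the last factor. *)
Lemma addr_regroup7 (V : zmodType) (a b c d e f g : V) :
  (a + b + e) + c + (f + d + g) = a + (b + c + d) + (e + f + g).
Proof. by rewrite !addrA (@GRing.add V).[ACl 1*2*4*6*3*5*7]. Qed.

(** The product of two elements may live in a third module, so that one notion
covers concatenation and the product, and can be tested for each of the four
pairings in [leibniz_reassoc]. *)
Definition leibniz (A B C : lmodType k) (dA : A -> A) (dB : B -> B) (dC : C -> C)
    (m : A -> B -> C) x y :=
  dC (m x y) = m (dA x) y + m x (dB y) + lam *: m (dA x) (dB y).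

Section RotaBaxter.
Variables (A : lmodType k) (mul : A -> A -> A) (P d : A -> A).
Hypotheses (bm : bilin mul) (lP : linear P) (ld : linear d).
Hypothesis (RB : forall x y,
  mul (P x) (P y) = P (mul (P x) y) + P (mul x (P y)) + lam *: P (mul x y)).

Let assoc x y z := mul (mul x y) z = mul x (mul y z).

(** Writing P(x)P(y) = P(s x y), both sides become P of a sum of seven products
of three factors, in which at most two factors carry P; associativity of these
matches them term by term. *)
Lemma assoc_PPP u v w :
  assoc u v w -> assoc (P u) v w -> assoc u (P v) w -> assoc u v (P w) ->
  assoc (P u) (P v) w -> assoc (P u) v (P w) -> assoc u (P v) (P w) ->
  assoc (P u) (P v) (P w).
Proof.
rewrite /assoc => a0 a1 a2 a3 a12 a13 a23.
have [mDl mDr mZl mZr] := bilinE bm; have [_ PD PZ] := linear_comb lP.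
pose s x y := mul (P x) y + mul x (P y) + lam *: mul x y.
have Ps x y : mul (P x) (P y) = P (s x y) by rewrite RB !PD PZ.
rewrite [in LHS](Ps u v) [in RHS](Ps v w) !Ps; congr (P _).
rewrite {1}/s -Ps [in RHS]/s -Ps /s !(mDl, mDr, mZl, mZr).
rewrite a0 a1 a2 a3 a12 a13 a23 !scalerDr.
by rewrite addr_regroup7.
Qed.

Hypothesis dP : forall x, d (P x) = P (d x).

(** Applying d to the Rota-Baxter identity gives P of three Leibniz expansions;
collecting their nine terms by the position of d, instead of by the position of
P, gives back three Rota-Baxter identities. *)
Lemma leibniz_PP x y :
  leibniz d d d mul (P x) y -> leibniz d d d mul x (P y) ->
  leibniz d d d mul x y -> leibniz d d d mul (P x) (P y).
Proof.
rewrite /leibniz => h1 h2 h0.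
have [_ PD PZ] := linear_comb lP; have [_ dD dZ] := linear_comb ld.
rewrite RB !(dD, dZ) !dP h1 h2 h0 !RB !dP !(PD, PZ).
by rewrite addr_zip3 scalerDr scalerDr addr_zip3 !scalerDr.
Qed.

End RotaBaxter.

(** If s(xt) = (sx)t, then expanding d(s(xt)) and d((sx)t) yields the same seven
terms.  Thus, of the four Leibniz rules for the pairings f, g, p, q, the two
inner ones and either outer one imply the other outer one; this is the step
that carries a Leibniz rule across a concatenation, on the left as well as on
the right.  The reassociation is requested only at x and dB x, since for words
it holds when the middle factor is not empty. *)
Lemma leibniz_reassoc (A B C D E F : lmodType k) (dA : A -> A) (dB : B -> B)
    (dC : C -> C) (dD : D -> D) (dE : E -> E) (f : A -> E -> F) (g : B -> C -> E)
    (p : A -> B -> D) (q : D -> C -> F) s x t :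
  bilin f -> bilin q ->
  (forall s' t', q (p s' x) t' = f s' (g x t')) ->
  (forall s' t', q (p s' (dB x)) t' = f s' (g (dB x) t')) ->
  leibniz dB dC dE g x t -> leibniz dA dB dD p s x ->
  f (dA s) (g x t) + f s (dE (g x t)) + lam *: f (dA s) (dE (g x t)) =
  q (dD (p s x)) t + q (p s x) (dC t) + lam *: q (dD (p s x)) (dC t).
Proof.
rewrite /leibniz => bf bq h h' -> ->.
have [_ fDr _ fZr] := bilinE bf; have [qDl _ qZl _] := bilinE bq.
rewrite !(fDr, fZr, qDl, qZl) !h !h' !scalerDr.
by rewrite addr_regroup7.
Qed.

End WeightedIdentities.

(** * The algebra of all bracketed words *)

Section WordAlgebra.
Variables (k : comPzRingType) (lam : k) (X : choiceType).
Local Notation kword := (freemod k (seq (letter X))).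
Local Notation base := (@fbase k (seq (letter X))).
Local Notation dia_word := (@dia_word k lam X).
Local Notation d_word := (@d_word k lam X).
Local Notation kcat := (@kcat k X).
Local Notation kP := (@kP k X).
Implicit Types (a b c : letter X) (u v w : word X) (s t x y : kword).

Definition kd : kword -> kword := lext d_word.
Definition dia : kword -> kword -> kword := bext dia_word.
(** Combinations of nonempty words: an empty middle factor would let its two
neighbours meet, and two P-letters that meet are not just concatenated. *)
Definition nonempty_supp : kword -> Prop := supp_in (fun w => w != [::]).

Lemma kd_linear : linear kd. Proof. exact: lext_is_linear. Qed.
Lemma kP_linear : linear kP. Proof. exact: lext_is_linear. Qed.
Lemma bext_bilin (T U : choiceType) (V : lmodType k) (f : T -> U -> V) :
  bilin (bext f).
Proof. by split=> *; [exact: bext_linearl | exact: bext_linearr]. Qed.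
Lemma dia_bilin : bilin dia. Proof. exact: bext_bilin. Qed.
Lemma kcat_bilin : bilin kcat. Proof. exact: bext_bilin. Qed.

Lemma kd_base w : kd (base w) = d_word w.
Proof. exact: lext_base. Qed.

Lemma kP_base w : kP (base w) = base [:: LP w].
Proof. exact: lext_base. Qed.

Lemma dia_base u v : dia (base u) (base v) = dia_word u v.
Proof. exact: bext_base. Qed.

Lemma dia_word0l v : dia_word [::] v = base v.
Proof. by rewrite /Defs.dia_word dia_rec_nP //; left. Qed.

Lemma dia_word0r u : dia_word u [::] = base u.
Proof. by rewrite /Defs.dia_word dia_rec_nP ?cats0 //; right. Qed.

Lemma kP_RB s t :
  dia (kP s) (kP t) = kP (dia (kP s) t) + kP (dia s (kP t)) + lam *: kP (dia s t).
Proof.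
have [bd lP] := (dia_bilin, kP_linear).
move: s t; apply: eq_bilin_base; first exact: bilin_pre.
  apply: bilinD; last by apply/bilinZ/bilin_post.
  by apply: bilinD; apply: bilin_post => //; apply: bilin_pre.
move=> u v; rewrite !kP_base !dia_base dia_word_PP; congr (_ + _).
exact: addrC.
Qed.

Lemma kd_kP s : kd (kP s) = kP (kd s).
Proof.
elim/fmod_ind: s => [|e s s' IH IH'|v].
- by rewrite /kd /Defs.kP !linear0.
- by rewrite !(kd_linear, kP_linear) IH IH'.
- by rewrite kP_base !kd_base d_word1.
Qed.

Lemma leibniz_kcat s t : leibniz lam kd kd kd kcat s t.
Proof.
have [bc ld] := (kcat_bilin, kd_linear).
move: s t; apply: eq_bilin_base; first exact: bilin_post.
  apply: bilinD; last by apply/bilinZ/bilin_pre.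
  by apply: bilinD; apply: bilin_pre.
by move=> u v; rewrite kcat_base !kd_base d_word_cat.
Qed.

Lemma nonempty_base w : w != [::] -> nonempty_supp (base w).
Proof. by move=> nw; apply: supp_in_base. Qed.

Lemma nonempty_kP s : nonempty_supp (kP s).
Proof.
apply: (@supp_in_lext _ _ _ (fun=> True)) => // w _; exact: nonempty_base.
Qed.

Lemma nonempty_kcat s t : nonempty_supp s -> nonempty_supp (kcat s t).
Proof.
by move=> ns; apply: (supp_kcat (S' := fun=> True) ns) => // -[].
Qed.

Lemma nonempty_d_letter a : nonempty_supp (d_letter lam a).
Proof.
by case: a => [x|w|w] /=; [exact: nonempty_base | exact: nonempty_base | exact: nonempty_kP].
Qed.

Lemma nonempty_d_word w : nonempty_supp (d_word w).
Proof.
case: w => [|a w]; first exact: supp_in0.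
have nd := @nonempty_d_letter a; rewrite d_word_cons.
apply: supp_inD; first apply: supp_inD; last apply: supp_inZ; apply: nonempty_kcat => //.
exact: nonempty_base.
Qed.

Lemma nonempty_kd s : nonempty_supp (kd s).
Proof.
apply: (@supp_in_lext _ _ _ (fun=> True)) => // w _; exact: nonempty_d_word.
Qed.

(** Only the last letter of the left factor takes part in a product. *)
Lemma dia_catl s x t : nonempty_supp x -> dia (kcat s x) t = kcat s (dia x t).
Proof.
have [bd bc] := (dia_bilin, kcat_bilin).
have lx : linear (fun y => dia (kcat s y) t).
  by move=> e y z /=; rewrite (bc.2 s) (bd.1 t).
have lx' : linear (fun y => kcat s (dia y t)).
  by move=> e y z /=; rewrite (bd.1 t) (bc.2 s).
apply: (eq_linear_on_supp lx lx') => u nu.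
move: s t {lx lx'}; apply: eq_bilin_base.
- exact: (bilin_pre bd (bc.1 (base u)) (@linear_id _ _)).
- exact: (bilin_pre bc (@linear_id _ _) (bd.2 (base u))).
move=> v w; rewrite kcat_base !dia_base; have [->|nw] := eqVneq w [::].
  by rewrite !dia_word0r kcat_base.
by rewrite -[w]cats0 dia_word_cat // kcat1r cats0.
Qed.

Lemma dia_catr s x t : nonempty_supp x -> dia s (kcat x t) = kcat (dia s x) t.
Proof.
have [bd bc] := (dia_bilin, kcat_bilin).
have lx : linear (fun y => dia s (kcat y t)).
  by move=> e y z /=; rewrite (bc.1 t) (bd.2 s).
have lx' : linear (fun y => kcat (dia s y) t).
  by move=> e y z /=; rewrite (bd.2 s) (bc.1 t).
apply: (eq_linear_on_supp lx lx') => u nu.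
move: s t {lx lx'}; apply: eq_bilin_base.
- exact: (bilin_pre bd (@linear_id _ _) (bc.2 (base u))).
- exact: (bilin_pre bc (bd.1 (base u)) (@linear_id _ _)).
move=> v w; rewrite kcat_base !dia_base; have [->|nv] := eqVneq v [::].
  by rewrite !dia_word0l kcat_base.
by rewrite -[v in LHS]cat0s dia_word_cat // kcat1l.
Qed.

Lemma dia1l t : dia (base [::]) t = t.
Proof.
elim/fmod_ind: t => [|e t t' IH IH'|w]; first exact: bext0r.
  by rewrite (dia_bilin.2 _) IH IH'.
by rewrite dia_base dia_word0l.
Qed.

Lemma dia1r t : dia t (base [::]) = t.
Proof.
elim/fmod_ind: t => [|e t t' IH IH'|w]; first exact: bext0l.
  by rewrite (dia_bilin.1 _) IH IH'.
by rewrite dia_base dia_word0r.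
Qed.

(** Against a letter that is not of the form P(u), the product is concatenation.
The derivative LD [:: a] of such a letter a is again one. *)
Lemma dia_nPl a t : ~~ isP a -> dia (base [:: a]) t = kcat (base [:: a]) t.
Proof.
move=> nPa; elim/fmod_ind: t => [|e t t' IH IH'|w]; first by rewrite kcat0r /dia bext0r.
  by rewrite (dia_bilin.2 _) (kcat_bilin.2 _) IH IH'.
rewrite dia_base kcat_base; case: w => [|b w]; first by rewrite dia_word0r.
by rewrite (@dia_word_nP _ _ _ [::]) // (negPf nPa).
Qed.

Lemma dia_nPr a t : ~~ isP a -> dia t (base [:: a]) = kcat t (base [:: a]).
Proof.
move=> nPa; elim/fmod_ind: t => [|e t t' IH IH'|w]; first by rewrite kcat0l /dia bext0l.
  by rewrite (dia_bilin.1 _) (kcat_bilin.1 _) IH IH'.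
rewrite dia_base kcat_base; case/lastP: w => [|w b]; first by rewrite dia_word0l.
by rewrite dia_word_nP // (negPf nPa) andbF.
Qed.

Lemma ldepth_LP w : ldepth (LP w) = (wdepth w).+1. Proof. by []. Qed.

(** The induction that follows the recursive definition of the product; the third
premise passes from the two letters that meet to the words containing them. *)
Lemma dia_ind (Q : word X -> word X -> Prop) :
  (forall v, Q [::] v) -> (forall u, Q u [::]) ->
  (forall u a b v, Q [:: a] [:: b] -> Q (rcons u a) (b :: v)) ->
  (forall a b, adjP a b -> Q [:: a] [:: b]) ->
  (forall u v, Q [:: LP u] v -> Q u [:: LP v] -> Q u v ->
     Q [:: LP u] [:: LP v]) ->
  forall u v, Q u v.
Proof.
move=> Q0l Q0r Qcat Qadj QPP u v.
have [n] := ubnP (wdepth u + wdepth v); elim: n u v => // n IH u v.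
case/lastP: u => // u a; case: v => // b v; rewrite -cats1 wdepth_cat !wdepth_cons.
rewrite /= maxn0 cats1 ltnS => le_n; apply: Qcat.
have {}le_n : (ldepth a + ldepth b <= n)%N.
  by apply: leq_trans le_n; rewrite leq_add ?leq_maxl ?leq_maxr.
have [/Qadj //|] := boolP (adjP a b); rewrite negbK.
case: a le_n => // u'; case: b => // v'; rewrite !ldepth_LP addSn => le_n _.
by apply: QPP; apply: IH; rewrite ?wdepth_cons ?ldepth_LP /= ?maxn0 ?addnS ?addSn //;
  apply: leq_trans le_n; rewrite ?addnS ?ltnS ?leqnSn.
Qed.

(** Induction along the product: the passage from letters to words is
[leibniz_reassoc], applied once for each side, two P-letters are handled by
[leibniz_PP], and otherwise the rule is that of concatenation. *)
Lemma leibniz_dia_word u v : leibniz lam kd kd kd dia (base u) (base v).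
Proof.
have kd0 : kd (base [::]) = 0 by rewrite kd_base.
have [bd ld] := (dia_bilin, kd_linear).
have [_ dD dZ] := linear_comb ld.
have d0l t : dia 0 t = 0 by exact: bext0l.
have d0r t : dia t 0 = 0 by exact: bext0r.
pattern u, v; apply: dia_ind u v.
- by move=> v; rewrite /leibniz kd0 !dia1l !d0l scaler0 add0r addr0.
- by move=> u; rewrite /leibniz kd0 !dia1r !d0r scaler0 !addr0.
- move=> u a b v ab.
  have na c : nonempty_supp (base [:: c]) by exact: nonempty_base.
  (* First extend the left letter to a word, then the right letter. *)
  have ub : leibniz lam kd kd kd dia (base (rcons u a)) (base [:: b]).
    rewrite -cats1 -kcat_base /leibniz (dia_catl _ _ (na a)) leibniz_kcat.
    apply: (leibniz_reassoc kcat_bilin dia_bilin _ _ ab (leibniz_kcat _ _)) => s' t'.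
      exact: dia_catl.
    by apply: dia_catl; exact: nonempty_kd.
  rewrite -cat1s -kcat_base /leibniz (dia_catr _ _ (na b)) leibniz_kcat; apply/esym.
  apply: (leibniz_reassoc dia_bilin kcat_bilin _ _ (leibniz_kcat _ _) ub) => s' t'.
    by rewrite dia_catr.
  by rewrite dia_catr //; exact: nonempty_kd.
- move=> a b; rewrite /adjP negb_and.
  have dnP c : ~~ isP c -> kd (base [:: c]) = base [:: LD [:: c]].
    by rewrite kd_base d_word1; case: c.
  case/orP => nP; rewrite /leibniz (dnP _ nP).
    by rewrite !dia_nPl // leibniz_kcat (dnP _ nP).
  by rewrite !dia_nPr // leibniz_kcat (dnP _ nP).
- move=> u v; rewrite -!kP_base; apply: leibniz_PP => //; try exact: kP_RB.
  + exact: kP_linear.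
  + exact: kd_kP.
Qed.

Lemma leibniz_dia s t : leibniz lam kd kd kd dia s t.
Proof.
have [bd ld] := (dia_bilin, kd_linear).
move: s t; apply: eq_bilin_base; first exact: bilin_post.
  apply: bilinD; last by apply/bilinZ/bilin_pre.
  by apply: bilinD; apply: bilin_pre.
by move=> u v; exact: leibniz_dia_word.
Qed.

Lemma dia_adj a b : adjP a b -> dia (base [:: a]) (base [:: b]) = base [:: a; b].
Proof. by move=> ab; rewrite dia_base (@dia_word_nP _ _ _ [::]). Qed.

Lemma nonempty_dia_letter a b : nonempty_supp (dia (base [:: a]) (base [:: b])).
Proof.
have [ab|] := boolP (adjP a b); first by rewrite dia_adj //; exact: nonempty_base.
rewrite negbK; case: a => // u; case: b => // v _.
rewrite -!kP_base kP_RB; apply: supp_inD; first apply: supp_inD; last apply: supp_inZ;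
  exact: nonempty_kP.
Qed.

(** When the middle word has at least two letters, the two products do not
interact.  Otherwise only three letters matter, and a letter that is not of the
form P(u) turns products into concatenations; three P-letters are left, to which
[assoc_PPP] applies with the induction on the total depth. *)
Lemma dia_assoc_word u v w :
  dia (dia (base u) (base v)) (base w) = dia (base u) (dia (base v) (base w)).
Proof.
have [n] := ubnP (wdepth u + wdepth v + wdepth w); elim: n u v w => // n IH u v w.
rewrite ltnS => le_n.
case/lastP: u le_n => [|u a] le_n; first by rewrite !dia1l.
case: w le_n => [|c w] le_n; first by rewrite !dia1r.
case: v le_n => [|b v] le_n; first by rewrite dia1r dia1l.
have na e : nonempty_supp (base [:: e]) by exact: nonempty_base.
have [->|nv] := eqVneq v [::]; last first.
  have nv' : nonempty_supp (base v) by exact: nonempty_base.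
  by rewrite -cat1s -kcat_base dia_catr // !dia_catl // dia_catr.
have nab := @nonempty_dia_letter.
(* Move the outer words u and w out of both triple products. *)
rewrite -cats1 -[c :: w]cat1s -!kcat_base !(dia_catr _ _ (na c)).
rewrite !(dia_catl _ _ (na a)) (dia_catl _ _ (nab a b)) (dia_catr _ _ (nab b c)).
rewrite -[LHS]kcatA; congr (kcat _ (kcat _ _)).
have {}le_n : (ldepth a + ldepth b + ldepth c <= n)%N.
  apply: leq_trans le_n; rewrite -cats1 wdepth_cat !wdepth_cons /= !maxn0.
  by rewrite leq_add ?leq_add ?leq_maxr ?leq_maxl.
have [Pa|nPa] := boolP (isP a); last first.
  by rewrite !(dia_nPl _ nPa) (dia_catl _ _ (na b)).
have [Pc|nPc] := boolP (isP c); last first.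
  by rewrite !(dia_nPr _ nPc) (dia_catr _ _ (na b)).
have [Pb|nPb] := boolP (isP b); last first.
  by rewrite (dia_nPl _ nPb) (dia_nPr _ nPb) (dia_catl _ _ (na b))
     (dia_catr _ _ (na b)) (dia_nPl _ nPb) (dia_nPr _ nPb) kcatA.
case: a b c Pa Pb Pc le_n {na} => // u' [] // v' [] // w' _ _ _.
rewrite !ldepth_LP !(addSn, addnS) => le_n.
rewrite -!kP_base; apply: assoc_PPP; rewrite ?kP_base; try exact: kP_RB;
  try exact: dia_bilin; try exact: kP_linear; apply: IH;
  by rewrite ?wdepth_cons ?ldepth_LP /= ?maxn0 ?(addnS, addSn);
     lia.
Qed.

Lemma dia_assoc : associative dia.
Proof.
move=> s t r; apply/esym; elim/fmod_ind: r => [|e r r' IH IH'|w].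
- by rewrite /dia !bext0r.
- by rewrite !(dia_bilin.2 _) IH IH'.
move: s t; apply: eq_bilin_base => [||u v]; last exact: dia_assoc_word.
- exact: bilin_post dia_bilin (dia_bilin.1 _).
- exact: (bilin_pre dia_bilin (@linear_id _ _) (dia_bilin.1 _)).
Qed.

End WordAlgebra.

(** * The operations on the span of X_infty *)

Section FreeAlgebra.
Variables (k : comPzRingType) (lam : k) (X : choiceType).
Local Notation XI := (classical_sets.set_type (Xinf X)).
Local Notation kX := (kXinf k X).
Local Notation kword := (freemod k (seq (letter X))).
Local Notation base := (@fbase k (seq (letter X))).
Local Notation kcat := (@kcat k X).
Local Notation kP := (@kP k X).
Local Notation dia := (@dia k lam X).
Local Notation kd := (@kd k lam X).
Local Notation incl := (@incl k X).
Local Notation restr := (@restr k X).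
Local Notation diaX := (@diaX k lam X).
Local Notation dX := (@dX k lam X).
Local Notation PX := (PX k X).

Lemma val_good (u : XI) : good (val u).
Proof. by rewrite -in_Xinf; exact: valP. Qed.

Lemma incl_inj : injective incl.
Proof. exact: can_inj (@inclK k X). Qed.

Lemma diaX_bilin : bilin diaX. Proof. exact: bext_bilin. Qed.
Lemma dX_linear : linear dX. Proof. exact: lext_is_linear. Qed.
Lemma PX_linear : linear PX. Proof. exact: lext_is_linear. Qed.

Lemma inclM a b : incl (diaX a b) = dia (incl a) (incl b).
Proof.
move: a b; apply: eq_bilin_base => [||u v].
- exact: bilin_post diaX_bilin (@incl_linear k X).
- exact: bilin_pre (@dia_bilin k lam X) (@incl_linear k X) (@incl_linear k X).
- by rewrite incl_diaX !incl_base dia_base.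
Qed.

Lemma incl_d a : incl (dX a) = kd (incl a).
Proof.
elim/fmod_ind: a => [|c a b IHa IHb|u].
- have [-> _ _] := linear_comb dX_linear.
  by rewrite linear0; have [-> _ _] := linear_comb (@kd_linear k lam X).
- by rewrite dX_linear !incl_linear kd_linear IHa IHb.
- by rewrite incl_dX incl_base kd_base.
Qed.

Lemma incl_P a : incl (PX a) = kP (incl a).
Proof.
elim/fmod_ind: a => [|c a b IHa IHb|u].
- have [-> _ _] := linear_comb PX_linear.
  by rewrite linear0; have [-> _ _] := linear_comb (@kP_linear k X).
- by rewrite PX_linear !incl_linear kP_linear IHa IHb.
- by rewrite incl_PX incl_base kP_base.
Qed.

(** A word without empty sub-words has a generator at the bottom; in particular
X_infty is empty when X is. *)
Lemma good_inhabited (w : word X) : good w -> inhabited X.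
Proof.
pose Q (a : letter X) := goodl a -> inhabited X.
pose Qs (w : word X) := all goodl w -> w != [::] -> inhabited X.
suff Qw : Qs w by case/andP=> w0 /andP[gw _]; exact: Qw gw w0.
apply: (@word_letter_ind X Q Qs) => //.
- by case=> [//|b [|//]] Qb /= db; apply: Qb => //=; rewrite is_delta_goodl.
- by move=> u Qu /and3P[u0 gu _]; exact: Qu gu u0.
- by move=> a u Qa _ /andP[/Qa].
Qed.

Lemma good1 (a : letter X) : good [:: a] = goodl a.
Proof. by rewrite /good /pregood /= !andbT. Qed.

(** If e is not 0 there is a generator x, and the coefficient of x in the product
of e with x is 0, as all its words are longer; it is also 1, so 1 = 0 in k. *)
Lemma dX_one e : left_id e diaX -> dX e = 0.
Proof.
move=> e1; have [d0 _ _] := linear_comb dX_linear.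
suff -> : e = 0 by [].
case Es: (fsupp e) => [|u s]; first by rewrite (fmodE e) Es big_nil.
have [x] := good_inhabited (val_good u).
have nincl : nonempty_supp (incl e).
  apply: (@supp_in_lext _ _ _ (fun=> True)) => // v _; apply: nonempty_base.
  by case/andP: (val_good v).
have long : supp_in (fun w => 1 < size w)%N (kcat (incl e) (base [:: Gen x])).
  apply: (supp_kcat (S' := eq [:: Gen x])) nincl _ _; first exact: supp_in_base.
  by move=> [//|a [|b w]] _ _ <-.
have : fcoef (kcat (incl e) (base [:: Gen x])) [:: Gen x] = 1.
  rewrite -(@dia_nPr k lam) // -[base [:: Gen x]](@incl_base k X (@Xword X [:: Gen x] isT)).
  by rewrite -inclM e1 incl_base fcoef_base eqxx.
rewrite fcoef_out => [k0|]; last by apply/negP => /long.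
by rewrite -[e]scale1r -k0 scale0r.
Qed.

Lemma kX_is_pdRB t : weight_of_type lam t -> is_pdRB lam t diaX dX PX.
Proof.
move=> wt; have [_ iD iZ] := linear_comb (@incl_linear k X); split=> //.
- split; [|exact: diaX_bilin.1|exact: diaX_bilin.2].
  by move=> a b c; apply: incl_inj; rewrite !inclM dia_assoc.
- split; [exact: dX_linear| |by move=> e e1 _; exact: dX_one].
  move=> a b; apply: incl_inj; rewrite !(iD, iZ) incl_d !inclM !incl_d.
  exact: leibniz_dia.
- split; first exact: PX_linear.
  move=> a b; apply: incl_inj.
  by rewrite !(iD, iZ) !(inclM, incl_P) kP_RB.
- by move=> a; apply: incl_inj; rewrite !(incl_d, incl_P) kd_kP.
Qed.

(** * Evaluation in a para-differential Rota-Baxter algebra *)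

Section Universal.
Variables (R : lmodType k) (mulR : R -> R -> R) (dR PR : R -> R).
Variables (t : pdRB_type) (f : X -> R).
Hypothesis HR : is_pdRB lam t mulR dR PR.

(** The target need not have an identity, so the product of the values of the
letters stops at the last letter; the value 0 at the empty word is a default,
compatible with linear operators. *)
Definition ev_letters (el : letter X -> R) : word X -> R :=
  fix ev w := if w is a :: w' then
    if w' is [::] then el a else mulR (el a) (ev w') else 0.

Fixpoint ev_letter (a : letter X) : R :=
  match a with
  | Gen x => f x
  | LD w => dR (ev_letters ev_letter w)
  | LP w => PR (ev_letters ev_letter w)
  end.

Definition ev_word : word X -> R := ev_letters ev_letter.
Definition ev : kword -> R := lext ev_word.

Lemma mulR_bilin : bilin mulR.
Proof. by split; case: (pdRB_algebra HR). Qed.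
Lemma mulRA : associative mulR.
Proof. by case: (pdRB_algebra HR). Qed.
Lemma dR_linear : linear dR.
Proof. by case: (pdRB_diff HR). Qed.
Lemma PR_linear : linear PR.
Proof. by case: (pdRB_RB HR). Qed.
Lemma ev_linear : linear ev.
Proof. exact: lext_is_linear. Qed.
Lemma ev_base w : ev (base w) = ev_word w.
Proof. exact: lext_base. Qed.

Lemma ev_cons a w : w != [::] ->
  ev_word (a :: w) = mulR (ev_letter a) (ev_word w).
Proof. by case: w. Qed.

Lemma ev_cat u v : u != [::] -> v != [::] ->
  ev_word (u ++ v) = mulR (ev_word u) (ev_word v).
Proof.
move=> + v0; elim: u => // a [|b u] IH _; first by rewrite cat1s (@ev_cons a v).
by rewrite cat_cons ev_cons // IH // (@ev_cons a (b :: u)) // mulRA.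
Qed.

Lemma ev_kcat s r : nonempty_supp s -> nonempty_supp r ->
  ev (kcat s r) = mulR (ev s) (ev r).
Proof.
have [bm bc le] := And3 mulR_bilin (@kcat_bilin k X) (@ev_linear).
move=> ns nr; pose Sn (w : word X) := w != [::].
apply: (@eq_linear_on_supp k _ R Sn (fun s => ev (kcat s r))
  (fun s => mulR (ev s) (ev r))) ns => [c x y|c x y|u nu] /=.
- by rewrite (bc.1 r) le.
- by rewrite le (bm.1 _).
apply: (@eq_linear_on_supp k _ R Sn (fun r => ev (kcat (base u) r))
  (fun r => mulR (ev (base u)) (ev r))) nr => [c x y|c x y|v nv] /=.
- by rewrite (bc.2 _) le.
- by rewrite le (bm.2 _).
by rewrite kcat_base !ev_base ev_cat.
Qed.

Lemma ev_kP s : ev (kP s) = PR (ev s).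
Proof.
elim/fmod_ind: s => [|c a b IHa IHb|u].
- have [-> _ _] := linear_comb (@kP_linear k X).
  have [-> _ _] := linear_comb (@ev_linear).
  by have [-> _ _] := linear_comb PR_linear.
- by rewrite kP_linear !ev_linear PR_linear IHa IHb.
- by rewrite kP_base !ev_base.
Qed.

Lemma ev_d_word w : ev (d_word lam w) = dR (ev_word w).
Proof.
have [ev0 evD evZ] := linear_comb (@ev_linear).
apply: (@word_letter_ind X (fun a => ev (d_letter lam a) = dR (ev_letter a))
  (fun w => ev (d_word lam w) = dR (ev_word w))).
- by move=> x; rewrite ev_base.
- by move=> u _; rewrite ev_base.
- by move=> u IH; rewrite d_letterP ev_kP IH (pdRB_comm HR).
- by have [-> _ _] := linear_comb dR_linear; exact: ev0.
move=> a [|b u] IHa IHw; first by rewrite d_word1 IHa.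
have [na nu] : nonempty_supp (base [:: a]) /\ nonempty_supp (base (b :: u)).
  by split; exact: nonempty_base.
have nda := @nonempty_d_letter k lam X a.
have ndu := @nonempty_d_word k lam X (b :: u).
rewrite d_word_cons !(evD, evZ) !ev_kcat // IHa IHw !ev_base (@ev_cons a (b :: u)) //.
by rewrite (diff_mul (pdRB_diff HR)).
Qed.

Lemma ev_kd s : ev (kd s) = dR (ev s).
Proof.
elim/fmod_ind: s => [|c a b IHa IHb|u].
- have [-> _ _] := linear_comb (@kd_linear k lam X).
  have [-> _ _] := linear_comb (@ev_linear).
  by have [-> _ _] := linear_comb dR_linear.
- by rewrite kd_linear !ev_linear dR_linear IHa IHb.
- by rewrite kd_base ev_d_word ev_base.
Qed.

(** Goodness matters here: the bodies of P-letters must be nonempty, because the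
default value of [ev_word] at the empty word is not a unit of R. *)
Lemma ev_dia_word u v : good u -> good v ->
  ev (dia (base u) (base v)) = mulR (ev_word u) (ev_word v).
Proof.
have [ev0 evD evZ] := linear_comb (@ev_linear).
pose Q u v := good u -> good v ->
  ev (dia (base u) (base v)) = mulR (ev_word u) (ev_word v).
move: u v; apply: (@dia_ind X Q) => //.
- move=> u a b v Qab gu gv.
  have ga : good [:: a].
    by case/andP: gu => _ /andP[]; rewrite all_rcons good1 => /andP[].
  have gb : good [:: b] by case/andP: gv => _ /andP[/andP[]]; rewrite good1.
  have na (c : letter X) : nonempty_supp (base [:: c]) by exact: nonempty_base.
  have nab := @nonempty_dia_letter k lam X a b.
  (* The empty prefix and suffix are set apart, since the value of the empty word
     is not a unit of R. *)
  have ub : nonempty_supp (dia (base (rcons u a)) (base [:: b])) /\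
    ev (dia (base (rcons u a)) (base [:: b])) = mulR (ev_word (rcons u a)) (ev_word [:: b]).
    case: u gu => [|c u] gu; first by split=> //; exact: Qab.
    rewrite -cats1 -kcat_base (dia_catl lam _ _ (na a)).
    have nu : nonempty_supp (base (c :: u)) by exact: nonempty_base.
    split; first exact: nonempty_kcat.
    by rewrite ev_kcat // Qab // ev_cat // mulRA ev_base.
  case: v gv => [|c v] gv; first by case: ub.
  have nv : nonempty_supp (base (c :: v)) by exact: nonempty_base.
  rewrite -cat1s -kcat_base (dia_catr lam _ _ (na b)) ev_kcat //; last by case: ub.
  by case: ub => _ ->; rewrite ev_cat // mulRA ev_base.
- move=> a b ab _ _; rewrite dia_adj // ev_base.
  by rewrite -[[:: a; b]]/([:: a] ++ [:: b]) ev_cat.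
- move=> u v Q1 Q2 Q3 gu gv.
  have [gu' gv'] : good u /\ good v.
    by move: gu gv; rewrite !good1 !goodlP.
  rewrite -!kP_base kP_RB !(evD, evZ) !ev_kP !kP_base Q1 // Q2 // Q3 //.
  by rewrite (RB_mul (pdRB_RB HR)).
Qed.

Definition fbar (a : kX) : R := ev (incl a).

Lemma fbar_base (u : XI) : fbar (fbase k u) = ev_word (val u).
Proof. by rewrite /fbar incl_base ev_base. Qed.

Lemma fbar_linear : linear fbar.
Proof. by move=> c a b; rewrite /fbar incl_linear ev_linear. Qed.

Lemma fbarM a b : fbar (diaX a b) = mulR (fbar a) (fbar b).
Proof.
move: a b; apply: eq_bilin_base => [||u v].
- exact: bilin_post diaX_bilin fbar_linear.
- exact: bilin_pre mulR_bilin fbar_linear fbar_linear.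
- by rewrite !fbar_base /fbar inclM !incl_base ev_dia_word ?val_good.
Qed.

(** A good word is obtained from generators by the three operations: P-letters and
letters D(b) come from PX and dX, and a word is the product of its first letter
with the rest since adjacent letters are not both P-letters. *)
Lemma hom_restr (g : kX -> R) : is_algebra_hom diaX mulR g ->
  (forall a, g (dX a) = dR (g a)) -> (forall a, g (PX a) = PR (g a)) ->
  (forall x, g (jX k X x) = f x) ->
  forall w, good w -> g (restr (base w)) = ev_word w.
Proof.
move=> [lg gM] gd gP gj w.
pose Q (a : letter X) := goodl a -> g (restr (base [:: a])) = ev_letter a.
pose Qs (w : word X) := good w -> g (restr (base w)) = ev_word w.
have restrE (w' : word X) (gw : good w') : incl (restr (base w')) = base w'.
  by rewrite -[w']/(val (Xword gw)) restr_base incl_base.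
apply: (@word_letter_ind X Q Qs) => //.
- by move=> x _; rewrite /= -gj /jX -restr_base.
- case=> [//|b [|//]] Qb /= db.
  have gb : good [:: b] by rewrite good1 is_delta_goodl.
  have -> : restr (base [:: LD [:: b]]) = dX (restr (base [:: b])).
    apply: incl_inj; rewrite incl_d !restrE // ?good1 //.
    by rewrite kd_base d_word1 d_letter_Delta.
  by rewrite gd Qb.
- move=> u Qu gu; have gu' : good u by rewrite goodlP in gu.
  have -> : restr (base [:: LP u]) = PX (restr (base u)).
    by apply: incl_inj; rewrite incl_P !restrE ?good1 // kP_base.
  by rewrite gP Qu.
- move=> a [|b u] Qa Qu gw; first by apply: Qa; rewrite -good1.
  have [ga gu ab] : [/\ goodl a, good (b :: u) & adjP a b].
    by move: gw; rewrite /good pregood_cons => /andP[_ /and3P[]].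
  have -> : restr (base [:: a, b & u]) =
      diaX (restr (base [:: a])) (restr (base (b :: u))).
    apply: incl_inj; rewrite inclM !restrE ?good1 // dia_base.
    by rewrite (@dia_word_nP _ _ _ [::]).
  by rewrite gM Qa // Qu.
Qed.

End Universal.

Lemma kX_free t : weight_of_type lam t ->
  is_free_pdRB lam t diaX dX PX (jX k X).
Proof.
move=> wt; split=> [|R mulR dR PR HR f]; first exact: kX_is_pdRB.
exists (fbar mulR dR PR f); split.
  split.
  - by split; [exact: fbar_linear | exact: fbarM HR].
  - by move=> a; rewrite /fbar incl_d (ev_kd _ HR).
  - by move=> a; rewrite /fbar incl_P (ev_kP _ HR).
  - by move=> x; rewrite fbar_base.
move=> g [hg gd gP gj]; apply/funext => a.
elim/fmod_ind: a => [|c a b IHa IHb|u].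
- have [-> _ _] := linear_comb (@fbar_linear R mulR dR PR f).
  by have [-> _ _] := linear_comb hg.1.
- by rewrite hg.1 fbar_linear IHa IHb.
- rewrite fbar_base -(hom_restr hg gd gP gj) ?val_good //.
  by rewrite restr_base.
Qed.

End FreeAlgebra.

Theorem theorem5p8 (k : comPzRingType) (X : choiceType) (lam : k) :
  (lam = 0 ->
    is_free_pdRB lam type_I (@diaX k lam X) (@dX k lam X) (PX k X) (jX k X)) /\
  (lam <> 0 ->
    is_free_pdRB lam type_II (@diaX k lam X) (@dX k lam X) (PX k X) (jX k X)).
Proof. by split=> wt; exact: kX_free. Qed.
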